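(* Let $\kappa$ be an inaccessible cardinal and let $K$ be the unique (up to isomorphism) $\kappa$-existentially closed group of cardinality $\kappa$. Let $\mathcal{G}_\kappa$ be the group with underlying set $$\prod_{\substack{\alpha<\kappa\\ \alpha\text{ is non-limit}}}\mathbf{C}_{G_\alpha}(G_{\alpha-1})$$ and the twisted multiplication defined in the context. Then there is a monomorphism $\mathcal{G}_\kappa\hookrightarrow Aut(K)$. In particular, $|Aut(K)|=2^\kappa$.
   Context: Inaccessible means uncountable and strongly inaccessible. For an infinite cardinal $\kappa$, a group $G$ with $|G|\ge\kappa$ is $\kappa$-existentially closed if every system of fewer than $\kappa$ many equations and inequations with coefficients in $G$ which has a solution in some supergroup $H\geqslant G$ already has a solution in $G$. It is known (earlier work) that for inaccessible $\kappa$ there is, up to isomorphism, exactly one $\kappa$-existentially closed group of cardinality $\kappa$. Let $n\ge 7$ and let $G=\bigcup_{\alpha<\kappa}G_\alpha$ be the limit of regular representations of length $\kappa$ with base $G_0=Sym(n)$: $G_{\alpha+1}=Sym(G_\alpha)$ with $G_\alpha\hookrightarrow G_{\alpha+1}$ via its right regular representation for all $\alpha<\kappa$ (products in symmetric groups are compositions of functions, and $x\in G_\alpha$ corresponds to the permutation $y\mapsto yx^{-1}$), and $G_\gamma=\varinjlim_{\alpha<\gamma}G_\alpha$ for limit $\gamma<\kappa$; each $G_\alpha$ is identified with its image, so the $G_\alpha$ form an increasing chain of subgroups of $G$. For inaccessible $\kappa$ the group $G$ is isomorphic to $K$ (known). The ordinal $0$ is non-limit. $\mathbf{C}_L(H)$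 denotes the centralizer of $H$ in $L$; set $G_{-1}=\{1_G\}$, so $\mathbf{C}_{G_0}(G_{-1})=G_0$. Write $\iota_g(x)=gxg^{-1}$. Elements of $\mathcal{G}_\kappa$ are sequences $\mathbf{g}=(g_\alpha:\alpha<\kappa,\ \alpha\text{ non-limit})$ with $g_\alpha\in\mathbf{C}_{G_\alpha}(G_{\alpha-1})$. For such $\mathbf{g}$ define automorphisms $\Phi^{\mathbf{g}}_\alpha$ of $G$ ($\alpha<\kappa$) recursively: $\Phi^{\mathbf{g}}_0=\iota_{g_0}$; $\Phi^{\mathbf{g}}_{\alpha+1}=\iota_{g_{\alpha+1}}\circ\Phi^{\mathbf{g}}_\alpha$; for limit $\gamma$, let $\Psi^{\mathbf{g}}_\gamma=\bigcup_{\alpha<\gamma}(\Phi^{\mathbf{g}}_\alpha\upharpoonright G_\alpha)$, which is an automorphism of $G_\gamma$, let $\psi^{\mathbf{g}}_\gamma\in G_{\gamma+1}=Sym(G_\gamma)$ be this permutation regarded as an element of $G$, and set $\Phi^{\mathbf{g}}_\gamma=\iota_{\psi^{\mathbf{g}}_\gamma}$. The multiplication on $\mathcal{G}_\kappa$ is $\mathbf{g}\cdot\mathbf{h}=(g_\alpha\,\Phi^{\mathbf{g}}_{\alpha-1}(h_\alpha):\alpha<\kappa,\ \alpha\text{ non-limit})$, where $\Phi^{\mathbf{g}}_{-1}(h_0)=h_0$; this makes $\mathcal{G}_\kappa$ a group. *)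

(* Defs.v *)
From HB Require Import structures.
From mathcomp Require Import all_boot all_order all_classical.

Set Implicit Arguments.
Unset Strict Implicit.
Unset Printing Implicit Defensive.

Import Order.TTheory.
Local Open Scope classical_set_scope.
Local Open Scope card_scope.
Local Open Scope group_scope.

(** * Cardinals and ordinals *)

Definition card_lt T U (A : set T) (B : set U) : Prop := ~ (B #<= A).

(** A cardinal is an initial ordinal: a well-ordered type all of whose proper
    initial segments are smaller than the whole; its elements are the
    ordinals [α < κ]. *)
Record inaccessible (d : Order.disp_t) (κ : orderType d) : Prop := {
  inacc_wo : forall A : set κ, A !=set0 ->
    exists2 m, A m & forall x, A x -> (m <= x)%O;
  inacc_card : forall a : κ, card_lt [set x | (x < a)%O] [set: κ];
  inacc_uncountable : card_lt [set: nat] [set: κ];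
  inacc_regular : forall A : set κ,
    (forall a, exists2 b, A b & (a <= b)%O) -> [set: κ] #<= A;
  inacc_strong_limit : forall A : set κ, card_lt A [set: κ] ->
    card_lt [set B | B `<=` A] [set: κ] }.

Section Ordinals.
Context {d : Order.disp_t} {κ : orderType d}.
Implicit Types α β γ : κ.

Definition is_zero α := forall β, (α <= β)%O.

(** The least element above [α]; the default value is never used when [κ] is
    inaccessible, since [κ] then has no largest element. *)
Definition osucc α : κ :=
  xget α [set β | (α < β)%O /\ forall δ, (α < δ)%O -> (β <= δ)%O].

Definition nonlimit α := is_zero α \/ exists β, α = osucc β.

Definition opred α : option κ :=
  match pselect (exists β, α = osucc β) with
  | left h => Some (projT1 (cid h))
  | right _ => None
  end.

Hypothesis hκ : inaccessible κ.

Lemma olt_wf : well_founded (fun α β => (α < β)%O).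
Proof.
move=> α; apply: contrapT => Nα.
have [m Nm minm] := inacc_wo hκ (ex_intro (fun x => ~ Acc _ x) α Nα).
apply: Nm; constructor=> β βm; apply: contrapT => Nβ.
by have := minm β Nβ; rewrite leNgt βm.
Qed.

Lemma osuccP α : (α < osucc α)%O /\ forall δ, (α < δ)%O -> (osucc α <= δ)%O.
Proof.
rewrite /osucc; case: xgetP => [β -> //|N]; exfalso.
suff [β αβ] : exists β, (α < β)%O.
  have [m αm minm] := inacc_wo hκ (ex_intro (fun x => (α < x)%O) β αβ).
  exact: (N m).
apply: contrapT => NB; apply: (inacc_uncountable hκ).
apply: (card_le_trans (B := [set α])).
  apply: (inacc_regular hκ) => a; exists α => //.
  by rewrite leNgt; apply/negP => αa; apply: NB; exists a.
exact/finite_set_countable.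
Qed.

Lemma osucc_gt α : (α < osucc α)%O. Proof. by case: (osuccP α). Qed.

Lemma osucc_le α β : (α < β)%O -> (osucc α <= β)%O.
Proof. by case: (osuccP α) => _; apply. Qed.

Lemma lt_osucc α β : (α < osucc β)%O = (α <= β)%O.
Proof.
apply/idP/idP => [|ab]; last exact: le_lt_trans ab (osucc_gt β).
by apply: contraTT; rewrite -ltNge -leNgt; apply: osucc_le.
Qed.

Lemma osucc_inj : injective (@osucc).
Proof.
move=> α β e; apply/eqP; rewrite eq_le.
by rewrite -lt_osucc -e osucc_gt -lt_osucc e osucc_gt.
Qed.

Lemma opred_osucc α : opred (osucc α) = Some α.
Proof.
rewrite /opred; case: pselect => [h|[]]; last by exists α.
by case: cid => β /= /osucc_inj ->.
Qed.

Lemma opred_Some α β : opred α = Some β -> α = osucc β.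
Proof. by rewrite /opred; case: pselect => // h [<-]; case: cid. Qed.

Lemma opred_zero α : is_zero α -> opred α = None.
Proof.
move=> z; case e: opred => [β|//]; have := z β.
by rewrite (opred_Some e) leNgt osucc_gt.
Qed.

Lemma opred_None α : nonlimit α -> opred α = None -> is_zero α.
Proof. by case=> // -[β ->]; rewrite opred_osucc. Qed.

Section Recursion.
Variables (T : Type) (t0 : T) (step : κ -> (κ -> T) -> T).

(** The values of the function below [α] are passed to [step α] as a total
    function that is [t0] outside of the initial segment below [α]. *)
Definition below α (f : κ -> T) : κ -> T :=
  fun β => if (β < α)%O then f β else t0.

Definition wfrec : κ -> T :=
  Fix olt_wf (fun=> T) (fun α rec => step α (fun β =>
    match @idP (β < α)%O with
    | ReflectT h => rec β h
    | ReflectF _ => t0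
    end)).

Lemma wfrecE α : wfrec α = step α (below α wfrec).
Proof.
rewrite /wfrec Fix_eq; last first.
  move=> a f g fg; congr step; apply/funext => b.
  by case: {-}_ / idP => // h; rewrite fg.
congr step; apply/funext => b; rewrite /below.
by case: {-}_ / idP => h; [rewrite h|rewrite (negbTE (introN idP h))].
Qed.

End Recursion.
End Ordinals.

(** * Groups *)

Definition sgpred (G : groupType) (S : groupClosed G) : pred G :=
  fun x => x \in S.
Record subgrp (G : groupType) (S : groupClosed G) :=
  SubGrp { sgval : G; _ : sgpred S sgval }.
HB.instance Definition _ G (S : groupClosed G) := [isSub for @sgval G S].
HB.instance Definition _ G (S : groupClosed G) := [Choice of subgrp S by <:].
HB.instance Definition _ G (S : groupClosed G) :=
  SubChoice_isSubGroup.Build G (sgpred S) (subgrp S)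
    (conj (@gpred1 _ S) (@gpredF _ S)).

Lemma sgvalM (G : groupType) (S : groupClosed G) (x y : subgrp S) :
  sgval (x * y) = sgval x * sgval y.
Proof. by []. Qed.
Lemma sgvalV (G : groupType) (S : groupClosed G) (x : subgrp S) :
  sgval x^-1 = (sgval x)^-1.
Proof. by []. Qed.

Lemma morphV (G H : groupType) (f : G -> H) : {morph f : x y / x * y} ->
  forall x, f x^-1 = (f x)^-1.
Proof.
move=> fM; have f1 : f 1 = 1 by apply: (@mulgI _ (f 1)); rewrite -fM !mulg1.
by move=> x; apply/esym/mulg1_eq; rewrite -fM mulgV.
Qed.

Record Sym (T : Type) := MkSym {
  sym_fun :> T -> T;
  sym_inv : T -> T;
  sym_funK : cancel sym_fun sym_inv;
  sym_invK : cancel sym_inv sym_fun }.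

Section SymGroup.
Variable T : Type.
Implicit Types s t : Sym T.

Lemma symP s t : s =1 t -> s = t.
Proof.
case: s t => [f f' fK f'K] [g g' gK g'K] /= /funext fg; subst g.
have e : f' = g' by apply/funext => x; apply: (can_inj fK); rewrite f'K g'K.
by subst g'; rewrite (Prop_irrelevance fK gK) (Prop_irrelevance f'K g'K).
Qed.

HB.instance Definition _ := gen_eqMixin (Sym T).
HB.instance Definition _ := gen_choiceMixin (Sym T).

Definition sym_one : Sym T := @MkSym T id id (fun=> erefl) (fun=> erefl).
Definition sym_opp s : Sym T := MkSym (@sym_invK _ s) (@sym_funK _ s).
(** The product is the composition of functions, [(s * t) x = s (t x)]; this
    is opposite to the convention of [perm]. *)
Definition sym_mul s t : Sym T :=
  MkSym (can_comp (@sym_funK _ s) (@sym_funK _ t))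
        (can_comp (@sym_invK _ t) (@sym_invK _ s)).

Fact sym_mulA : associative sym_mul. Proof. by move=> *; apply: symP. Qed.
Fact sym_mul1g : left_id sym_one sym_mul.
Proof. by move=> *; apply: symP. Qed.
Fact sym_mulg1 : right_id sym_one sym_mul.
Proof. by move=> *; apply: symP. Qed.
Fact sym_mulVg : left_inverse sym_one sym_opp sym_mul.
Proof. by move=> s; apply: symP => x; apply: sym_funK. Qed.
Fact sym_mulgV : right_inverse sym_one sym_opp sym_mul.
Proof. by move=> s; apply: symP => x; apply: sym_invK. Qed.

HB.instance Definition _ :=
  isGroup.Build (Sym T) sym_mulA sym_mul1g sym_mulg1 sym_mulVg sym_mulgV.

Lemma symM s t x : (s * t) x = s (t x). Proof. by []. Qed.
Lemma symKV s x : s (s^-1 x) = x. Proof. exact: sym_invK. Qed.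
Lemma symVK s x : s^-1 (s x) = x. Proof. exact: sym_funK. Qed.

End SymGroup.

Definition autom (K : groupType) : {pred Sym K} :=
  fun s => `[< {morph s : x y / x * y} >].
Arguments autom : clear implicits.

Fact autom1 K : 1 \in autom K. Proof. exact/asboolP. Qed.
Fact automM K : mulg_closed (autom K).
Proof.
move=> s t /asboolP sM /asboolP tM; apply/asboolP => x y.
by rewrite !symM tM sM.
Qed.
Fact automV K : invg_closed (autom K).
Proof.
move=> s /asboolP sM; apply/asboolP => x y.
by rewrite -{1}[x](symKV s) -{1}[y](symKV s) -sM symVK.
Qed.
HB.instance Definition _ (K : groupType) := isMulClosed.Build (Sym K) (autom K) (@automM K).
HB.instance Definition _ (K : groupType) := isInvClosed.Build (Sym K) (autom K) (@automV K).
HB.instance Definition _ (K : groupType) := isMul1Closed.Build (Sym K) (autom K) (@autom1 K).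

Definition Aut (K : groupType) : groupType :=
  subgrp (GroupClosed.clone _ (autom K) _).

(** The centralizer of [H] in [L]. *)
Definition centralizer (G : groupType) (L H : {pred G}) : {pred G} :=
  fun x => (x \in L) && `[< forall y, y \in H -> commute x y >].

Definition inner (G : groupType) (g x : G) : G := g * x * g^-1.

Section Inner.
Variable G : groupType.

Let gA (x y z : G) : x * (y * z) = x * y * z. Proof. exact: mulgA. Qed.
Let gK (x y : G) : x * y * y^-1 = x. Proof. exact: mulgK. Qed.
Let gVK (x y : G) : x * y^-1 * y = x. Proof. exact: mulgVK. Qed.

Lemma innerM (g x y : G) : inner g (x * y) = inner g x * inner g y.
Proof. by rewrite /inner !gA gVK. Qed.

Lemma innerK (g : G) : cancel (inner g) (inner g^-1).
Proof. by move=> x; rewrite /inner !gA mulVg mul1g gK. Qed.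

Lemma innerKV (g : G) : cancel (inner g^-1) (inner g).
Proof. by move=> x; rewrite -{1}[g]invgK innerK. Qed.

Lemma inner_comp (g h x : G) : inner (g * h) x = inner g (inner h x).
Proof. by rewrite /inner invgM !gA. Qed.

Lemma inner_comm (g x : G) : commute x g -> inner g x = x.
Proof. by rewrite /inner => <-; rewrite gK. Qed.

End Inner.

(** * Existentially closed groups *)

(** Group words in the variables [X] with coefficients in [G]. *)
Inductive gterm (G X : Type) : Type :=
| GCst of G
| GVar of X
| GMul of gterm G X & gterm G X
| GInv of gterm G X.

Fixpoint geval (G : Type) (H : groupType) (X : Type) (i : G -> H) (v : X -> H)
    (t : gterm G X) : H :=
  match t with
  | GCst g => i g
  | GVar x => v x
  | GMul t u => geval i v t * geval i v u
  | GInv t => (geval i v t)^-1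
  end.

(** [(true, (t, u))] is the equation [t = u] and [(false, (t, u))] is the
    inequation [t <> u]. *)
Definition gsystem (G X : Type) := set (bool * (gterm G X * gterm G X)).

Definition solves (G : Type) (H : groupType) (X : Type) (i : G -> H)
    (v : X -> H) (S : gsystem G X) : Prop :=
  forall b t u, S (b, (t, u)) ->
    if b then geval i v t = geval i v u else geval i v t <> geval i v u.

(** Supergroups of [G] are given by injective morphisms [G -> H]. *)
Definition existentially_closed (d : Order.disp_t) (κ : orderType d)
    (G : groupType) : Prop :=
  [set: κ] #<= [set: G] /\
  forall (X : Type) (S : gsystem G X), card_lt S [set: κ] ->
    (exists (H : groupType) (i : {multiplicative G -> H}) (v : X -> H),
       injective i /\ solves i v S) ->
    exists v : X -> G, solves id v S.

(** * Limits of regular representations *)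

Section RegrepLimit.
Context {d : Order.disp_t} {κ : orderType d}.

(** The group [G], its increasing chain of subgroups [G_α = rl_stage α] and
    the identifications of [G_(α+1)] with [Sym(G_α)] under which [x \in G_α]
    becomes the permutation [y |-> y * x^-1].  These data are determined by
    [κ] and [n] up to isomorphism. *)
Record regrep_limit (hκ : inaccessible κ) (n : nat) := RegrepLimit {
  rl_group :> groupType;
  rl_stage : κ -> groupClosed rl_group;
  rl_sym : forall α,
    {multiplicative subgrp (rl_stage (osucc α)) -> Sym (subgrp (rl_stage α))};
  rl_le : forall α β, (α <= β)%O -> {subset rl_stage α <= rl_stage β};
  rl_zero : forall α, is_zero α ->
    exists φ : {multiplicative Sym 'I_n -> subgrp (rl_stage α)}, bijective φ;
  rl_sym_bij : forall α, bijective (rl_sym α);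
  rl_sym_reg : forall α (x y : subgrp (rl_stage α))
    (x' : subgrp (rl_stage (osucc α))),
    val x' = val x -> rl_sym α x' y = y * x^-1;
  rl_limit : forall γ, ~ nonlimit γ -> forall x, x \in rl_stage γ ->
    exists2 α, (α < γ)%O & x \in rl_stage α;
  rl_cover : forall x, exists α, x \in rl_stage α }.

Context {hκ : inaccessible κ} {n : nat} (L : regrep_limit hκ n).
Implicit Types α β γ : κ.

(** [G_(α-1)], with [G_(-1) = {1}]. *)
Definition rl_prev α : {pred L} :=
  if opred α is Some β then mem (rl_stage L β) else pred1 (1 : L).

(** Families indexed by the non-limit ordinals below [κ]. *)
Local Notation rawseq := ({α : κ | nonlimit α} -> L).

Section Phi.
Variable g : rawseq.

(** For [γ] limit and [f α] the values [Φ_α] for [α < γ]: the element of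
    [G_(γ+1)] that, as a permutation of [G_γ], is the union of the
    restrictions of [f α] to [G_α]. *)
Definition psi γ (f : κ -> L -> L) : L :=
  xget (1 : L) [set p | exists2 s : subgrp (rl_stage L (osucc γ)), val s = p &
    forall α (x : subgrp (rl_stage L γ)), (α < γ)%O ->
      val x \in rl_stage L α -> val (rl_sym L γ s x) = f α (val x)].

Definition Phi_step α (f : κ -> L -> L) : L -> L :=
  match pselect (nonlimit α) with
  | left h =>
      if opred α is Some β then inner (g (exist _ α h)) \o f β
      else inner (g (exist _ α h))
  | right _ => inner (psi α f)
  end.

Definition Phi : κ -> L -> L := wfrec hκ id Phi_step.

(** [Φ_(α-1)], with [Φ_(-1)] the identity. *)
Definition Phi_prev α : L -> L := if opred α is Some β then Phi β else id.

Lemma Phi_nonlimit α (h : nonlimit α) x :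
  Phi α x = inner (g (exist _ α h)) (Phi_prev α x).
Proof.
rewrite /Phi wfrecE /Phi_step /Phi_prev; case: pselect => // h'.
rewrite (Prop_irrelevance h' h); case e: opred => [β|//] /=.
have βα : (β < α)%O by rewrite (opred_Some e) osucc_gt.
by rewrite /below βα.
Qed.

Lemma Phi_zero α (h : nonlimit α) : is_zero α ->
  Phi α = inner (g (exist _ α h)).
Proof.
by move=> z; apply/funext => x; rewrite (Phi_nonlimit h) /Phi_prev opred_zero.
Qed.

Lemma Phi_osucc α (h : nonlimit (osucc α)) :
  Phi (osucc α) = inner (g (exist _ (osucc α) h)) \o Phi α.
Proof.
by apply/funext => x; rewrite (Phi_nonlimit h) /Phi_prev opred_osucc.
Qed.

Lemma Phi_limit γ : ~ nonlimit γ -> Phi γ = inner (psi γ Phi).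
Proof.
move=> Nγ; rewrite {1}/Phi wfrecE /Phi_step; case: pselect => // _.
congr inner; rewrite /psi; congr xget; apply/seteqP; split=> p /= -[s sp H].
  by exists s => // α x αγ xα; rewrite (H α) // /below αγ.
by exists s => // α x αγ xα; rewrite (H α) // /below αγ.
Qed.

End Phi.

(** The product of the centralizers of [G_(α-1)] in [G_α], over the
    non-limit [α < κ]. *)
Record twisted := Twisted {
  tw_seq :> rawseq;
  tw_in : forall a, tw_seq a \in centralizer (rl_stage L (sval a))
                                             (rl_prev (sval a)) }.

Definition rawmul (g h : rawseq) : rawseq :=
  fun a => g a * Phi_prev g (sval a) (h a).

Local Notation G_ := (rl_stage L).

Lemma inner_in α (g x : L) : g \in G_ α -> x \in G_ α -> inner g x \in G_ α.
Proof. by move=> gα xα; rewrite /inner !gpredM ?gpredV. Qed.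

Lemma nlim_succ α : nonlimit (osucc α). Proof. by right; exists α. Qed.

(** The properties of [Φ_α] that make [Ψ_γ] an automorphism of [G_γ] at the
    next limit [γ]. *)
Record Phi_good (g : rawseq) α : Prop := PhiGood {
  Phi_inner : exists2 c, c \in G_ (osucc α) & Phi g α = inner c;
  Phi_stage : forall x, (Phi g α x \in G_ α) = (x \in G_ α);
  Phi_coh : forall β x, (β <= α)%O -> x \in G_ β -> Phi g α x = Phi g β x }.

Lemma Phi_goodM g α x y : Phi_good g α ->
  Phi g α (x * y) = Phi g α x * Phi g α y.
Proof. by case=> -[c _ ->] _ _; apply: innerM. Qed.

Lemma Phi_good_inj g α : Phi_good g α -> injective (Phi g α).
Proof. by case=> -[c _ ->] _ _; apply: can_inj (innerK c). Qed.

Lemma Phi_good_surj g α y : Phi_good g α -> exists x, Phi g α x = y.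
Proof. by case=> -[c _ ->] _ _; exists (inner c^-1 y); apply: innerKV. Qed.

(** [s] is the permutation [Ψ_γ]. *)
Definition is_Psi (g : rawseq) γ (s : subgrp (G_ (osucc γ))) :=
  forall α (x : subgrp (G_ γ)), (α < γ)%O -> val x \in G_ α ->
    val (rl_sym L γ s x) = Phi g α (val x).
Arguments is_Psi : clear implicits.

Lemma limit_stage γ (x : subgrp (G_ γ)) : ~ nonlimit γ ->
  exists2 α, (α < γ)%O & val x \in G_ α.
Proof. by move=> Nγ; apply: (rl_limit Nγ); apply: (valP x). Qed.

Lemma is_Psi_uniq g γ s t : ~ nonlimit γ ->
  is_Psi g γ s -> is_Psi g γ t -> s = t.
Proof.
move=> Nγ Hs Ht; apply: (bij_inj (rl_sym_bij L γ)); apply: symP => x.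
have [α αγ xα] := limit_stage x Nγ.
by apply: val_inj; rewrite (Hs α) // (Ht α).
Qed.

Lemma psi_Psi g γ s : ~ nonlimit γ -> is_Psi g γ s -> psi γ (Phi g) = val s.
Proof.
move=> Nγ Hs; rewrite /psi; case: xgetP => [p _ [t <- Ht]|N].
  by congr val; apply: is_Psi_uniq Ht Hs.
by case: (N (val s)); exists s.
Qed.

Lemma Psi_exists g γ : ~ nonlimit γ ->
  (forall α, (α < γ)%O -> Phi_good g α) -> exists s, is_Psi g γ s.
Proof.
move=> Nγ IH.
have coh α β x : (α < γ)%O -> (β < γ)%O -> x \in G_ α -> x \in G_ β ->
    Phi g α x = Phi g β x.
  move=> αγ βγ xα xβ; case/orP: (le_total α β) => ab.
    by rewrite (Phi_coh (IH _ βγ) ab xα).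
  by rewrite (Phi_coh (IH _ αγ) ab xβ).
have [F HF] : exists F : subgrp (G_ γ) -> subgrp (G_ γ),
    forall α (x : subgrp (G_ γ)), (α < γ)%O -> val x \in G_ α ->
      val (F x) = Phi g α (val x).
  suff /choice [F HF] : forall x : subgrp (G_ γ), exists y : subgrp (G_ γ),
      forall α, (α < γ)%O -> val x \in G_ α -> val y = Phi g α (val x).
    by exists F => α x; apply: HF.
  move=> x; have [α αγ xα] := limit_stage x Nγ.
  have yγ : Phi g α (val x) \in G_ γ.
    by apply: (rl_le (ltW αγ)); rewrite (Phi_stage (IH _ αγ)).
  by exists (SubGrp yγ) => β βγ xβ; apply: coh.
have Finj : injective F.
  move=> x y e; have [α αγ xα] := limit_stage x Nγ.
  have [β βγ yβ] := limit_stage y Nγ; apply: val_inj.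
  have [δ [δγ xδ yδ]] : exists δ, [/\ (δ < γ)%O, val x \in G_ δ
      & val y \in G_ δ].
    case/orP: (le_total α β) => ab; first by exists β; rewrite (rl_le ab).
    by exists α; rewrite (rl_le ab yβ).
  by apply: (Phi_good_inj (IH _ δγ)); rewrite -!HF // e.
have Fsurj (y : subgrp (G_ γ)) : exists x : subgrp (G_ γ), F x = y.
  have [α αγ yα] := limit_stage y Nγ.
  have [x xy] := Phi_good_surj (val y) (IH _ αγ).
  have xα : x \in G_ α by rewrite -(Phi_stage (IH _ αγ)) xy.
  exists (SubGrp (rl_le (ltW αγ) xα)).
  by apply: val_inj; rewrite (HF α).
have [F' F'K] := choice Fsurj.
have [k _ kK] := rl_sym_bij L γ.
exists (k (MkSym (fun x => Finj _ _ (F'K (F x))) F'K)) => α x αγ xα.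
by rewrite kK; apply: HF.
Qed.

Lemma rl_sym_inner γ (s : subgrp (G_ (osucc γ))) (x y : subgrp (G_ γ)) :
  {morph rl_sym L γ s : u v / u * v} ->
  rl_sym L γ s x = y -> inner (val s) (val x) = val y.
Proof.
move=> sM sx.
have up (z : subgrp (G_ γ)) : val z \in G_ (osucc γ).
  by apply: (rl_le (ltW (osucc_gt hκ γ))); apply: (valP z).
have -> : val x = val (SubGrp (up x)) by [].
have -> : val y = val (SubGrp (up y)) by [].
rewrite /inner -sgvalV -!sgvalM; congr sgval.
have fM := @gmulfM _ _ (rl_sym L γ).
apply: (bij_inj (rl_sym_bij L γ)); apply: symP => u.
rewrite !fM (morphV fM) !symM (@rl_sym_reg _ _ L γ x _ (SubGrp (up x))) //.
by rewrite (@rl_sym_reg _ _ L γ y _ (SubGrp (up y))) // sM symKV (morphV sM) sx.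
Qed.

Lemma is_Psi_morph g γ s : ~ nonlimit γ ->
  (forall α, (α < γ)%O -> Phi_good g α) -> is_Psi g γ s ->
  {morph rl_sym L γ s : u v / u * v}.
Proof.
move=> Nγ IH Hs x y; apply: val_inj.
have [α αγ xα] := limit_stage x Nγ; have [β βγ yβ] := limit_stage y Nγ.
have [δ [δγ xδ yδ]] : exists δ, [/\ (δ < γ)%O, val x \in G_ δ
    & val y \in G_ δ].
  case/orP: (le_total α β) => ab; first by exists β; rewrite (rl_le ab).
  by exists α; rewrite (rl_le ab yβ).
have xyδ : val (x * y) \in G_ δ by exact: gpredM.
rewrite [RHS]sgvalM (Hs δ (x * y)) // -/(val _) -/(val _) !(Hs δ) //.
exact: (Phi_goodM _ _ (IH _ δγ)).
Qed.

Lemma twP (g : twisted) α (h : nonlimit α) :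
  g (exist _ α h) \in G_ α /\
  forall x, x \in rl_prev α -> commute (g (exist _ α h)) x.
Proof. by have /andP[? /asboolP] := tw_in g (exist _ α h). Qed.

Lemma rl_prev_succ α : rl_prev (osucc α) =i G_ α.
Proof. by move=> x; rewrite /rl_prev opred_osucc. Qed.

Lemma Phi_goodP (g : twisted) α : Phi_good g α.
Proof.
elim/(well_founded_ind (olt_wf hκ)): α => α IH.
have [h|Nα] := pselect (nonlimit α); last first.
  have [s Hs] := Psi_exists Nα IH.
  have E := Phi_limit g Nα; rewrite (psi_Psi Nα Hs) in E.
  have act := rl_sym_inner (is_Psi_morph Nα IH Hs).
  have inv x : x \in G_ α -> inner (val s)^-1 x \in G_ α.
    move=> xα; have := act _ (SubGrp xα) (symKV (rl_sym L α s) (SubGrp xα)).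
    by move=> /(congr1 (inner (val s)^-1)); rewrite innerK /= => <-; exact: valP.
  split; first by exists (val s); [exact: valP|].
    move=> x; rewrite E; apply/idP/idP => [xα|xα].
      by rewrite -(innerK (val s) x) inv.
    by rewrite (act (SubGrp xα) _ erefl); exact: valP.
  move=> β x; rewrite le_eqVlt => /orP[/eqP -> //|βα xβ].
  rewrite E (act (SubGrp (rl_le (ltW βα) xβ)) _ erefl).
  by rewrite (Hs β).
have [gα gC] := twP g h.
case e: (opred α) => [β|]; last first.
  have z := opred_None hκ h e; rewrite /=.
  have E := Phi_zero g h z.
  split.
  - by exists (g (exist _ α h)) => //; apply: rl_le gα; apply/ltW/osucc_gt.
  - move=> x; rewrite E; apply/idP/idP => [xα|]; last exact: inner_in.
    by rewrite -(innerK (g (exist _ α h)) x) inner_in ?gpredV.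
  - move=> β x βα _; suff -> : β = α by [].
    by apply/eqP; rewrite eq_le βα z.
have eα := opred_Some e; subst α.
have Iβ := IH β (osucc_gt hκ β).
have [c cβ Ec] := Phi_inner Iβ.
set a := g _ in gα gC.
have E x : Phi g (osucc β) x = inner (a * c) x.
  by rewrite (Phi_osucc g h) /= Ec inner_comp.
have acβ : a * c \in G_ (osucc β) by rewrite gpredM.
split.
- exists (a * c); last exact/funext.
  by apply: rl_le acβ; apply/ltW/osucc_gt.
- move=> x; rewrite E; apply/idP/idP => [xα|]; last exact: inner_in.
  by rewrite -(innerK (a * c) x) inner_in ?gpredV.
move=> δ x; rewrite le_eqVlt => /orP[/eqP -> //|].
rewrite (lt_osucc hκ) => δβ xδ; rewrite E inner_comp -Ec inner_comm.
  exact: (Phi_coh Iβ).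
apply/commute_sym/gC; rewrite rl_prev_succ (Phi_stage Iβ).
exact: rl_le xδ.
Qed.

Lemma PhiM (g : twisted) α : {morph Phi g α : x y / x * y}.
Proof. by move=> x y; apply: Phi_goodM; apply: Phi_goodP. Qed.

Lemma Phi_inj (g : twisted) α : injective (Phi g α).
Proof. exact/Phi_good_inj/Phi_goodP. Qed.

Lemma Phi_surj (g : twisted) α y : exists x, Phi g α x = y.
Proof. exact/Phi_good_surj/Phi_goodP. Qed.

Lemma Phi_prevM (g : twisted) α : {morph Phi_prev g α : x y / x * y}.
Proof. by rewrite /Phi_prev; case: opred => // β; apply: PhiM. Qed.

Lemma Phi_prev_cent (g : twisted) α x :
  (Phi_prev g α x \in centralizer (G_ α) (rl_prev α)) =
  (x \in centralizer (G_ α) (rl_prev α)).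
Proof.
rewrite /Phi_prev; case e: opred => [β|//]; have eα := opred_Some e; subst α.
have Iβ := Phi_goodP g β; have [c cβ Ec] := Phi_inner Iβ.
have inα u : (Phi g β u \in G_ (osucc β)) = (u \in G_ (osucc β)).
  rewrite Ec; apply/idP/idP => [uα|]; last exact: inner_in.
  by rewrite -(innerK c u) inner_in ?gpredV.
congr andb; first exact: inα.
apply/asboolP/asboolP => H y; rewrite rl_prev_succ => yβ.
  apply: (@Phi_inj g β); rewrite !PhiM; apply: H.
  by rewrite rl_prev_succ (Phi_stage Iβ).
have [z zy] := Phi_surj g β y; rewrite -zy /commute -!PhiM; congr Phi.
by apply: H; rewrite rl_prev_succ -(Phi_stage Iβ) zy.
Qed.

Lemma centM α : mulg_closed (centralizer (G_ α) (rl_prev α)).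
Proof.
move=> x y /andP[xα /asboolP xC] /andP[yα /asboolP yC].
apply/andP; split; first exact: gpredM.
apply/asboolP => z zβ.
by apply/commute_sym/commuteM; apply/commute_sym; [apply: xC|apply: yC].
Qed.

Lemma cent1 α : 1 \in centralizer (G_ α) (rl_prev α).
Proof.
apply/andP; split; first exact: gpred1.
by apply/asboolP => z _; apply/commute_sym/commute1.
Qed.

Lemma centV α : invg_closed (centralizer (G_ α) (rl_prev α)).
Proof.
move=> x /andP[xα /asboolP xC]; apply/andP; split; first by rewrite gpredV.
by apply/asboolP => z zβ; apply/commute_sym/commuteV/commute_sym/xC.
Qed.

Lemma twistedP (g h : twisted) : tw_seq g =1 tw_seq h -> g = h.
Proof.
case: g h => [g gP] [h hP] /= /funext gh; subst h.
by rewrite (Prop_irrelevance gP hP).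
Qed.

Fact tw_mul_subproof (g h : twisted) a :
  rawmul g h a \in centralizer (G_ (sval a)) (rl_prev (sval a)).
Proof. by apply: centM; rewrite ?Phi_prev_cent; apply: tw_in. Qed.

Definition tw_mul (g h : twisted) : twisted :=
  Twisted (@tw_mul_subproof g h).

Definition tw_one : twisted := Twisted (fun a => cent1 (sval a)).

(** [(g^-1)_α] is the preimage of [(g_α)^-1] under [Φ_(α-1)]. *)
Definition rawinv (g : twisted) : rawseq :=
  fun a => xget (1 : L) [set x | Phi_prev g (sval a) x = (g a)^-1].

Lemma rawinvP (g : twisted) a : Phi_prev g (sval a) (rawinv g a) = (g a)^-1.
Proof.
rewrite /rawinv; case: xgetP => [//|N].
suff [x Hx] : exists x, Phi_prev g (sval a) x = (g a)^-1 by case: (N x).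
rewrite /Phi_prev; case: opred => [β|]; first exact: Phi_surj.
by exists (g a)^-1.
Qed.

Fact tw_inv_subproof (g : twisted) a :
  rawinv g a \in centralizer (G_ (sval a)) (rl_prev (sval a)).
Proof.
by rewrite -(Phi_prev_cent g) rawinvP; apply/centV/tw_in.
Qed.

Definition tw_inv (g : twisted) : twisted := Twisted (@tw_inv_subproof g).

Lemma Phi_mul (g h : twisted) α : Phi (tw_mul g h) α = Phi g α \o Phi h α.
Proof.
elim/(well_founded_ind (olt_wf hκ)): α => α IH.
have [k|Nα] := pselect (nonlimit α).
  have Eprev x :
      Phi_prev (tw_mul g h) α x = Phi_prev g α (Phi_prev h α x).
    rewrite /Phi_prev; case e: opred => [β|//].
    by rewrite IH // (opred_Some e) osucc_gt.
  apply/funext => x /=; rewrite !(Phi_nonlimit _ k) /= Eprev.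
  rewrite /rawmul /= inner_comp; congr inner.
  by rewrite /inner !Phi_prevM (morphV (@Phi_prevM g α)).
have I (f : twisted) β : (β < α)%O -> Phi_good f β.
  by move=> _; apply: Phi_goodP.
have [s Hs] := Psi_exists Nα (I g); have [t Ht] := Psi_exists Nα (I h).
have Hst : is_Psi (tw_mul g h) α (s * t).
  move=> β x βα xβ; rewrite gmulfM symM IH //= (Hs β) ?(Ht β) //.
  by rewrite (Phi_stage (Phi_goodP h β)).
rewrite !Phi_limit // (psi_Psi Nα Hs) (psi_Psi Nα Ht) (psi_Psi Nα Hst).
by apply/funext => x; rewrite gmulfM inner_comp.
Qed.

Lemma Phi_prev_mul (g h : twisted) α x :
  Phi_prev (tw_mul g h) α x = Phi_prev g α (Phi_prev h α x).
Proof. by rewrite /Phi_prev; case: opred => // β; rewrite Phi_mul. Qed.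

Lemma Phi_one α x : Phi tw_one α x = x.
Proof.
have E : tw_mul tw_one tw_one = tw_one.
  apply: twistedP => a; rewrite /= /rawmul mul1g.
  apply: (@mulgI _ (Phi_prev tw_one (sval a) 1)).
  by rewrite -Phi_prevM !mulg1.
by apply: (@Phi_inj tw_one α); rewrite -{3}E Phi_mul.
Qed.

Fact tw_mulA : associative tw_mul.
Proof.
move=> f g h; apply: twistedP => a /=.
by rewrite /rawmul /= /rawmul Phi_prev_mul Phi_prevM mulgA.
Qed.

Fact tw_mul1g : left_id tw_one tw_mul.
Proof.
move=> g; apply: twistedP => a; rewrite /= /rawmul mul1g /Phi_prev.
by case: opred => // β; apply: Phi_one.
Qed.

Fact tw_mulg1 : right_id tw_one tw_mul.
Proof.
move=> g; apply: twistedP => a; rewrite /= /rawmul.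
apply: (@mulIg _ (Phi_prev g (sval a) 1)).
by rewrite -mulgA -Phi_prevM mulg1.
Qed.

Fact tw_mulgV : right_inverse tw_one tw_inv tw_mul.
Proof.
by move=> g; apply: twistedP => a; rewrite /= /rawmul rawinvP mulgV.
Qed.

Fact tw_mulVg : left_inverse tw_one tw_inv tw_mul.
Proof.
move=> g; rewrite -[LHS]tw_mulg1 -(tw_mulgV (tw_inv g)).
rewrite -tw_mulA [X in tw_mul _ X]tw_mulA.
by rewrite tw_mulgV tw_mul1g tw_mulgV.
Qed.

HB.instance Definition _ := gen_eqMixin twisted.
HB.instance Definition _ := gen_choiceMixin twisted.
HB.instance Definition _ :=
  isGroup.Build twisted tw_mulA tw_mul1g tw_mulg1 tw_mulVg tw_mulgV.

End RegrepLimit.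

Arguments twisted {d κ hκ n} L.

(* Main.v *)
(* A κ-existentially closed group K and the limit L of regular representations
   share an extension property: a group H with |H| < κ embeds into the group so as
   to extend a prescribed embedding of a subgroup.  For K, the system expressing
   this is solvable in Sym(H * K).  For L, the embedding of H comes from an action
   of H on some G_γ, and G_(γ+1) = Sym(G_γ); such an action extending that of the
   subgroup is obtained from an equivariant bijection between H * L and L,
   restricted to a limit stage γ closed under it.

   With this property, every partial isomorphism of size < κ has two incompatible
   extensions of size < κ with prescribed elements in the domain and in the range.
   Back-and-forth along κ, choosing at each stage one of the two, yields a family
   of distinct isomorphisms indexed by the subsets of κ.  Hence K is isomorphic to
   L and |Aut(K)| = 2^κ.

   The union of the restrictions of Φ^g_α to G_α is an automorphism of L.  It
   determines g because G_α has trivial centre for non-limit α. *)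

Require Import Defs.
From HB Require Import structures.
From mathcomp Require Import all_boot all_order all_classical.

Set Implicit Arguments.
Unset Strict Implicit.
Unset Printing Implicit Defensive.

Import Order.TTheory.
Local Open Scope classical_set_scope.
Local Open Scope card_scope.
Local Open Scope group_scope.

(** * Cardinal comparison through total functions injective on a set *)

Lemma inj_card_leP T U (A : set T) (B : set U) (f : T -> U) :
  (forall x, A x -> B (f x)) -> (forall x y, A x -> A y -> f x = f y -> x = y) ->
  A #<= B.
Proof.
move=> fAB fI; have fI' : {in A &, injective f}.
  by move=> x y; rewrite !inE; apply: fI.
rewrite -(card_le_eql (inj_card_eq fI')); apply: subset_card_le.
by move=> _ [x Ax <-]; apply: fAB.
Qed.

(** The functions obtained from cardinal comparisons live on set types. This makes them total, with
    the default [u0] outside [A]. *)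
Lemma extend_fun T U (u0 : U) (A : set T) (f : A -> U) :
  exists F : T -> U, forall x (h : x \in A), F x = f (exist _ x h).
Proof.
exists (fun x => if @idP (x \in A) is ReflectT h then f (exist _ x h) else u0) => x h.
by case: {-}_ / idP => // h'; rewrite (bool_irrelevance h h').
Qed.

Lemma card_le_inj T U (u0 : U) (A : set T) (B : set U) : A #<= B ->
  exists2 f : T -> U, (forall x, A x -> B (f x)) &
    forall x y, A x -> A y -> f x = f y -> x = y.
Proof.
move=> /card_leP[f]; have [u uE] := extend_fun u0 (fun x => val (f x)).
exists u => [x /mem_set h|x y /mem_set hx /mem_set hy].
  by rewrite (uE x h); apply: set_mem; exact: valP.
rewrite (uE x hx) (uE y hy) => /val_inj e.
have /(_ (mem_set I) (mem_set I) e) := @inj _ _ _ f (exist _ x hx) (exist _ y hy).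
by move=> /(congr1 val).
Qed.

Lemma card_eq_inverse T U (t0 : T) (u0 : U) (A : set T) (B : set U) : A #= B ->
  exists (f : T -> U) (g : U -> T),
    [/\ forall x, A x -> B (f x), forall y, B y -> A (g y),
      forall x, A x -> g (f x) = x & forall y, B y -> f (g y) = y].
Proof.
move=> /card_bijP[f [g fK gK]].
have [F FE] := extend_fun u0 (fun x => val (f x)).
have [G GE] := extend_fun t0 (fun x => val (g x)).
exists F, G; split=> [x /mem_set h|y /mem_set h|x /mem_set h|y /mem_set h].
- by rewrite (FE x h); apply: set_mem; exact: valP.
- by rewrite (GE y h); apply: set_mem; exact: valP.
- rewrite (FE x h); case e: (f _) => [y hy] /=; rewrite (GE y hy).
  by have := fK (exist _ x h); rewrite e => ->.
- rewrite (GE y h); case e: (g _) => [x hx] /=; rewrite (FE x hx).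
  by have := gK (exist _ y h); rewrite e => ->.
Qed.

Lemma image_set_inj T U (f : T -> U) : injective f -> injective (image^~ f).
Proof.
by move=> fI A B e; apply/seteqP; split=> x; rewrite -!(image_inj fI) e.
Qed.

Lemma card_le_set T U : [set: T] #<= [set: U] -> [set: set T] #<= [set: set U].
Proof.
move=> TU; have [[u0]|N0] := pselect (inhabited U); last first.
  have NT : T -> False.
    by move=> t; have /card_leP[f] := TU; apply: N0; constructor;
       apply: (val (f (exist _ t (mem_set I)))).
  apply: (@inj_card_leP _ _ _ _ (fun=> set0)) => // A B _ _ _.
  by apply/funext => t; case: (NT t).
have [f _ fI] := card_le_inj u0 TU.
apply: (@inj_card_leP _ _ _ _ (image^~ f)) => // A B _ _.
by apply: image_set_inj => x y; apply: fI.
Qed.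

(** * Arithmetic of the cardinals below κ *)

Section SmallSets.
Context {d : Order.disp_t} {κ : orderType d} (hκ : inaccessible κ).

Local Notation small A := (card_lt A [set: κ]).

Lemma small_le T U (A : set T) (B : set U) : A #<= B -> small B -> small A.
Proof. by move=> AB sB /card_le_trans - /(_ _ _ AB). Qed.

Lemma small_sub T (A B : set T) : A `<=` B -> small B -> small A.
Proof. by move=> /subset_card_le/small_le. Qed.

Lemma small_image T U (f : T -> U) (A : set T) : small A -> small (f @` A).
Proof. exact/small_le/card_image_le. Qed.

Lemma small_inj T U (f : T -> U) (A : set T) (B : set U) :
  (forall x, A x -> B (f x)) -> (forall x y, A x -> A y -> f x = f y -> x = y) ->
  small B -> small A.
Proof. by move=> fAB fI; apply/small_le/(inj_card_leP fAB fI). Qed.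

Lemma small_countable T (A : set T) : countable A -> small A.
Proof. by move=> cA; apply: small_le cA (inacc_uncountable hκ). Qed.

Lemma small_bounded (A : set κ) : small A -> exists a, forall x, A x -> (x < a)%O.
Proof.
move=> sA; apply: contrapT => NA; apply: sA; apply: (inacc_regular hκ) => a.
apply: contrapT => Nb; apply: NA; exists a => x Ax.
by rewrite ltNge; apply/negP => ax; apply: Nb; exists x.
Qed.

Lemma olt_inhab : inhabited κ.
Proof.
apply: contrapT => N; apply: (small_countable (countable0 nat)).
suff -> : [set: κ] = set0 by exact: card_ge0.
by apply/seteqP; split => // x _; apply: N; constructor.
Qed.

Lemma small_initial T (A : set T) : small A ->
  exists a : κ, A #<= [set x | (x < a)%O].
Proof.
move=> sA; have [[t0]|N0] := pselect (inhabited T); last first.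
  have [a] := olt_inhab; exists a; have -> : A = set0; last exact: card_ge0.
  by apply/seteqP; split=> // t _; apply: N0; constructor.
pose step (α : κ) (f : κ -> option T) : option T :=
  if pselect (exists t, A t /\ forall β, (β < α)%O -> f β <> Some t) is left h
  then Some (projT1 (cid h)) else None.
pose f := wfrec hκ None step.
have fP α : (exists2 t, f α = Some t & A t /\ forall β, (β < α)%O -> f β <> Some t)
    \/ f α = None /\ forall t, A t -> exists2 β, (β < α)%O & f β = Some t.
  rewrite {1 3}/f wfrecE -/f /step; case: pselect => [h|N].
    left; case: cid => t [At H] /=; exists t => //; split=> // β βα.
    by have := H β βα; rewrite /below βα.
  right; split=> // t At; apply: contrapT => Nt; apply: N.
  exists t; split=> // β βα; rewrite /below βα => e.
  by apply: Nt; exists β.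
have [[α fα]|Nα] := pselect (exists α, f α = None).
  have [[t]|[_ H]] := fP α; first by rewrite fα.
  exists α; have /choice[g gP] t : exists β, A t -> (β < α)%O /\ f β = Some t.
    have [/H[β βα fβ]|NA] := pselect (A t); first by exists β.
    by exists α.
  apply: (@inj_card_leP _ _ _ _ g) => [t /gP[]//|t u /gP[_ gt] /gP[_ gu] e].
  by move: gt; rewrite e gu => -[].
exfalso; apply: sA; apply: (@inj_card_leP _ _ _ _ (fun α => odflt t0 (f α))).
  by move=> α _; have [[t -> []]|[fα]] := fP α => //; case: Nα; exists α.
move=> α β _ _; have [[t ft [_ tN]]|[fα]] := fP α; last by case: Nα; exists α.
have [[u fu [_ uN]]|[fβ]] := fP β; last by case: Nα; exists β.
rewrite ft fu /= => tu; apply/eqP; case: ltgtP => // ab.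
  by case: (uN α ab); rewrite ft tu.
by case: (tN β ab); rewrite fu tu.
Qed.

Lemma small_lekappa T (A : set T) : small A -> A #<= [set: κ].
Proof.
by move=> /small_initial[a /card_le_trans]; apply; apply: card_leT.
Qed.

(** The strong limit axiom speaks of subsets of κ, so [T] is first replaced by an initial
    segment. *)
Lemma small_power T : small [set: T] -> small [set: set T].
Proof.
move=> /small_initial[a Ta]; have [f fa fI] := card_le_inj a Ta.
apply: small_le (inacc_strong_limit hκ (inacc_card hκ (a := a))).
apply: (@inj_card_leP _ _ _ _ (image^~ f)) => [A _ _ [x _ <-]|A B _ _].
  exact: fa.
by apply: image_set_inj => x y; apply: fI.
Qed.

(** Suppose [f] injects κ into the union and [i x] is an index of a set containing [f x]. Each fibre
    of [i] is small, hence bounded by some [b j], and these bounds lie below a common [c]. Then [c]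
    itself satisfies [c < b (i c) < c]. *)
Lemma small_bigcup I T (D : set I) (F : I -> set T) : small D ->
  (forall i, D i -> small (F i)) -> small (\bigcup_(i in D) F i).
Proof.
move=> sD sF NF; have [α0] := olt_inhab.
have [t0] : inhabited T.
  have /card_leP[f] := NF; constructor.
  exact: (val (f (exist _ α0 (mem_set Logic.I)))).
have [f fF fI] := card_le_inj t0 NF.
have /choice[i iP] x : exists i, D i /\ F i (f x).
  by have [//|i Di Fi] := fF x; exists i.
have /choice[b bP] j : exists b, D j -> forall x, i x = j -> (x < b)%O.
  have [Dj|NDj] := pselect (D j); last by exists α0.
  have [|b bP] := @small_bounded [set x | i x = j]; last by exists b.
  apply: (@small_inj _ _ f _ _ _ _ (sF j Dj)) => [x <-|x y _ _].
    by case: (iP x).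
  exact: fI.
have [c cP] := small_bounded (small_image (f := b) sD).
have [Dc _] := iP c.
have bc : (b (i c) < c)%O by apply: cP; exists (i c).
by have := lt_trans (bP _ Dc c erefl) bc; rewrite ltxx.
Qed.

Lemma small_setX T U (A : set T) (B : set U) : small A -> small B ->
  small (A `*` B).
Proof.
move=> sA sB; apply: (@small_sub _ _ (\bigcup_(x in A) (pair x) @` B)).
  by move=> [x y] [Ax By]; exists x => //; exists y.
by apply: small_bigcup => // x _; apply: small_image.
Qed.

Lemma small_setU T (A B : set T) : small A -> small B -> small (A `|` B).
Proof.
move=> sA sB.
apply: (@small_sub _ _ (\bigcup_(b in [set: bool]) if b then A else B)).
  by move=> x []; [exists true|exists false].
by apply: small_bigcup => [|[]//]; apply/small_countable/countableP.
Qed.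

(** For each length the sequences form a small set by induction, and there are countably many
    lengths. Membership is expressed by [nth] since [T] has no decidable equality. *)
Lemma small_seq T (A : set T) : small A ->
  small [set s : seq T | forall i x0, (i < size s)%N -> A (nth x0 s i)].
Proof.
move=> sA.
pose F := fix F n : set (seq T) := if n is n'.+1 then
  (fun p => p.1 :: p.2) @` (A `*` F n') else [set [::]].
apply: (@small_sub _ _ (\bigcup_(n in [set: nat]) F n)).
  move=> s sP; exists (size s) => //; elim: s sP => //= x s IH sP.
  exists (x, s) => //=; split; first exact: (sP 0 x).
  by apply: IH => i; apply: (sP i.+1).
apply: small_bigcup => [|n _]; first exact/small_countable/countableP.
elim: n => [|n IH] /=; first exact/small_countable/countable1.
by apply: small_image; apply: small_setX.
Qed.

Lemma small_seg (a : κ) : small [set x | (x < a)%O].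
Proof. exact: inacc_card. Qed.

(* Recursion on the rank [a] places the fibre of [r] over [a] in [κ], avoiding
   the values taken on lower fibres, which are bounded by regularity. *)
Lemma card_le_rank T (r : T -> κ) :
  (forall a, small [set x | (r x <= a)%O]) -> [set: T] #<= [set: κ].
Proof.
move=> sr; have [α0] := olt_inhab.
have /choice[next nextP] (p : κ * (κ -> T -> κ)) : exists g : T -> κ,
    (forall x y, r x = p.1 -> r y = p.1 -> g x = g y -> x = y) /\
    forall x y, r x = p.1 -> (r y < p.1)%O -> p.2 (r y) y <> g x.
  case: p => α f /=.
  have [b bP] : exists b, forall y, (r y < α)%O -> (f (r y) y < b)%O.
    have [|b bP] := @small_bounded ((fun y => f (r y) y) @` [set y | (r y < α)%O]).
      by apply: small_image; apply: small_sub (sr α) => y; apply: ltW.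
    by exists b => y yα; apply: bP; exists y.
  (* The fibre is small, so it embeds into κ, and κ embeds into the final segment above [b], which
     is unbounded. *)
  have : [set x | r x = α] #<= [set x | (b <= x)%O].
    have /small_lekappa/card_le_trans : small [set x | r x = α].
      by apply: small_sub (sr α) => x /= ->.
    apply; apply: (inacc_regular hκ) => a; exists (Order.max a b) => /=.
      by rewrite le_max lexx orbT.
    by rewrite le_max lexx.
  move=> /(card_le_inj α0)[g gb gI]; exists g; split=> // x y rx ry e.
  by have := bP y ry; rewrite e ltNge gb.
pose φ := wfrec hκ (fun=> α0) (fun α f => next (α, f)).
apply: (@inj_card_leP _ _ _ _ (fun x => φ (r x) x)) => // x y _ _.
have avoid u v : (r u < r v)%O -> φ (r u) u <> φ (r v) v.
  move=> uv; rewrite {2}/φ wfrecE -/φ.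
  have [_ /(_ v u erefl uv)] := nextP (r v, below (fun=> α0) (r v) φ).
  by rewrite /= /below uv.
case: (ltgtP (r x) (r y)) => [/avoid //|/avoid N /esym//|e].
rewrite e /φ wfrecE -/φ.
by have [H _] := nextP (r y, below (fun=> α0) (r y) φ); apply: H.
Qed.

(** Ranked by the maximum of the coordinates, the pairs of rank at most [a] lie in the square of an
    initial segment. *)
Lemma card_kappa2 : [set: κ * κ] #<= [set: κ].
Proof.
apply: (@card_le_rank _ (fun p => Order.max p.1 p.2)) => a.
apply: (@small_sub _ _ ([set x | (x < osucc a)%O] `*` [set x | (x < osucc a)%O])).
  by move=> [x y] /=; rewrite ge_max !(lt_osucc hκ) => /andP[].
by apply: small_setX; apply: small_seg.
Qed.

Lemma card_prod_kappa T U : [set: T] #<= [set: κ] -> [set: U] #<= [set: κ] ->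
  [set: T * U] #<= [set: κ].
Proof.
have [α0] := olt_inhab => /(card_le_inj α0)[f _ fI] /(card_le_inj α0)[g _ gI].
apply: card_le_trans card_kappa2.
apply: (@inj_card_leP _ _ _ _ (fun p => (f p.1, g p.2))) => // -[x y] [x' y'].
by move=> _ _ [/(fI _ _ I I) /= -> /(gI _ _ I I) /= ->].
Qed.

Lemma card_eq_kappa T U (A : set T) (B : set U) : A #<= [set: κ] -> ~ small A ->
  B #<= [set: κ] -> ~ small B -> A #= B.
Proof.
move=> Aκ /contrapT κA Bκ /contrapT κB; apply/card_eqPle.
by split; [apply: card_le_trans Aκ κB|apply: card_le_trans Bκ κA].
Qed.

(* The closure point is the supremum of the orbit of [a] under a strictly
   increasing function dominating [F]. *)
Lemma limit_closed (F : κ -> κ) (a : κ) : exists γ : κ,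
  [/\ ~ nonlimit γ, (a < γ)%O & forall α, (α < γ)%O ->
    exists β, [/\ (α <= β)%O, (F β < γ)%O & (β < γ)%O]].
Proof.
pose b n := iter n (fun x => osucc (Order.max x (F x))) a.
have bS n : (b n < b n.+1)%O /\ (F (b n) < b n.+1)%O.
  by rewrite /b /= !(lt_osucc hκ) !le_max !lexx orbT.
have [c cP] : exists c, forall n, (b n < c)%O.
  have [|c cP] := @small_bounded (range b).
    by apply: small_image; apply/small_countable/countableP.
  by exists c => n; apply: cP; exists n.
have [γ γP γm] := inacc_wo hκ (ex_intro (fun x => forall n, (b n < x)%O) c cP).
have lim α : (α < γ)%O -> exists n, (α <= b n)%O.
  move=> αγ; apply: contrapT => N; have := γm α; rewrite leNgt αγ => /(_ _)/negP.
  by apply=> // n; rewrite ltNge; apply/negP => αn; apply: N; exists n.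
exists γ; split; [|exact: (γP 0)|].
  case=> [z|[β e]]; first by have := z a; rewrite leNgt (γP 0).
  have /lim[n βn] : (β < γ)%O by rewrite e osucc_gt.
  have := γP n.+1; rewrite e (lt_osucc hκ) leNgt.
  by rewrite (le_lt_trans βn (bS n).1).
move=> α /lim[n αn]; exists (b n); split=> //.
exact: lt_trans (bS n).2 (γP _).
Qed.

End SmallSets.

(** * Subgroups, graphs of partial isomorphisms and coset representatives *)

Record is_subgroup (G : groupType) (A : set G) : Prop := IsSubgroup {
  sub1 : A 1;
  subM : forall x y, A x -> A y -> A (x * y);
  subV : forall x, A x -> A x^-1 }.

(** The extension property quantifies over group types. This turns a subgroup given as a set into
    such a type. *)
Lemma subgroup_type (G : groupType) (A : set G) : is_subgroup A ->
  exists (H : groupType) (i : H -> G),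
    [/\ {morph i : x y / x * y}, injective i & range i = A].
Proof.
case=> A1 AM AV; pose P : {pred G} := fun x => x \in A.
have PM : mulg_closed P by move=> x y; rewrite !inE; apply: AM.
have P1 : 1 \in P by rewrite inE.
have PV : invg_closed P by move=> x; rewrite !inE; apply: AV.
pose S : groupClosed G := HB.pack_for (groupClosed G) P
  (isMulClosed.Build G P PM) (isMul1Closed.Build G P P1)
  (isInvClosed.Build G P PV).
exists (subgrp S), (@sgval G S); split=> [//||]; first exact: val_inj.
apply/seteqP; split=> [_ [x _ <-]|x Ax]; first by apply: set_mem; apply: (valP x).
by exists (SubGrp (mem_set Ax : sgpred S x)).
Qed.

Lemma gmorph1 (G H : groupType) (f : G -> H) : {morph f : x y / x * y} -> f 1 = 1.
Proof. by move=> fM; apply: (@mulgI _ (f 1)); rewrite -fM !mulg1. Qed.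

Lemma gmorph_inj (G H : groupType) (f : G -> H) : {morph f : x y / x * y} ->
  (forall x, f x = 1 -> x = 1) -> injective f.
Proof.
move=> fM f1 x y e; apply: divg1_eq; apply: f1.
by rewrite fM (morphV fM) e mulgV.
Qed.

(** Finite products of elements of [A] and their inverses, so that the cardinality is bounded by
    counting sequences. *)
Definition generated (G : groupType) (A : set G) : set G :=
  (fun s : seq G => \prod_(x <- s) x) @`
    [set s | forall i x0, (i < size s)%N -> (A `|` (fun x => x^-1) @` A) (nth x0 s i)].

Lemma generatedP (G : groupType) (A : set G) : is_subgroup (generated A).
Proof.
split.
- by exists [::] => //; rewrite big_nil.
- move=> _ _ [s sA <-] [t tA <-]; exists (s ++ t); last by rewrite big_cat.
  move=> i x0; rewrite size_cat nth_cat => ist.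
  case: (ltnP i (size s)) => [|si]; first exact: sA.
  by apply: tA; rewrite ltn_subLR.
- move=> _ [s sA <-]; exists (rev [seq x^-1 | x <- s]).
    move=> i x0; rewrite size_rev size_map => si.
    have si' : (size s - i.+1 < size s)%N by rewrite -subSn // subSS leq_subr.
    rewrite nth_rev ?size_map // (nth_map x0) //.
    case: (sA _ x0 si') => [Ax|[x Ax <-]]; last by left; rewrite invgK.
    by right; exists (nth x0 s (size s - i.+1)).
  by rewrite -map_rev big_map prodgV revK.
Qed.

Lemma sub_generated (G : groupType) (A : set G) : A `<=` generated A.
Proof.
move=> x Ax; exists [:: x]; last by rewrite big_seq1.
by case=> // x0 _; left.
Qed.

(** An isomorphism between subgroups of [M] and [N] is encoded by its graph, a subgroup of [M * N].
    Triviality of the two kernels makes it single-valued and injective, and exchanging the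
    coordinates gives the inverse. *)
Record partial_iso (M N : groupType) (R : set (M * N)) : Prop := PartialIso {
  piso_sub : is_subgroup R;
  piso_fun : forall y, R (1, y) -> y = 1;
  piso_inj : forall x, R (x, 1) -> x = 1 }.

Section PartialIso.
Context {M N : groupType} {R : set (M * N)} (HR : partial_iso R).

Lemma piso_div p q : R p -> R q -> R (p.1 / q.1, p.2 / q.2).
Proof.
case: HR => -[R1 RM RV] _ _; case: p q => [x y] [x' y'] Rp Rq.
exact: (RM _ _ Rp (RV _ Rq)).
Qed.

Lemma piso_funP x y y' : R (x, y) -> R (x, y') -> y = y'.
Proof.
move=> Rp /(piso_div Rp) /=; rewrite mulgV => /(piso_fun HR).
exact: divg1_eq.
Qed.

Lemma piso_injP x x' y : R (x, y) -> R (x', y) -> x = x'.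
Proof.
move=> Rp /(piso_div Rp) /=; rewrite mulgV => /(piso_inj HR).
exact: divg1_eq.
Qed.

Lemma piso_swap : partial_iso [set p : N * M | R (p.2, p.1)].
Proof.
case: HR => -[R1 RM RV] Rf Ri; split=> //; split=> //= [[x y] [x' y']|[x y]] /=.
  exact: RM.
exact: RV.
Qed.

End PartialIso.

Lemma range_piso (H M N : groupType) (u : H -> M) (v : H -> N) :
  {morph u : x y / x * y} -> {morph v : x y / x * y} ->
  injective u -> injective v -> partial_iso (range (fun h => (u h, v h))).
Proof.
move=> uM vM uI vI; have [u1 v1] := (gmorph1 uM, gmorph1 vM).
split; first split.
- by exists 1 => //; rewrite u1 v1.
- by move=> _ _ [g _ <-] [h _ <-]; exists (g * h) => //; rewrite uM vM.
- by move=> _ [g _ <-]; exists g^-1 => //; rewrite (morphV uM) (morphV vM).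
- by move=> y [g _ [e <-]]; move: e; rewrite -u1 => /uI ->; rewrite v1.
- by move=> y [g _ [<- e]]; move: e; rewrite -v1 => /vI ->; rewrite u1.
Qed.

(* As a [D]-set under left multiplication, [G] is [D] times the range of [s]. *)
Lemma coset_section (E G : groupType) (D : set E) (p : E -> G) :
  is_subgroup D -> {morph p : x y / x * y} ->
  (forall e, D e -> p e = 1 -> e = 1) ->
  exists (δ : G -> E) (s : G -> G),
    [/\ forall x, D (δ x), forall x, x = p (δ x) * s x,
        forall e x, D e -> s (p e * x) = s x,
        forall e x, D e -> δ (p e * x) = e * δ x
      & forall x, s (s x) = s x /\ δ (s x) = 1].
Proof.
case=> D1 DM DV pM p1.
have pI e e' : D e -> D e' -> p e = p e' -> e = e'.
  move=> De De' ee'; apply: divg1_eq; apply: p1; first exact/DM/DV.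
  by rewrite pM (morphV pM) ee' mulgV.
(* The set passed to [xget] is the coset of [x], so all points of one coset receive the same
   representative. It contains [x], so the default is never taken. *)
pose s x := xget (1 : G) [set y | exists2 e, D e & x = p e * y].
have sP x : exists2 e, D e & x = p e * s x.
  rewrite /s; case: xgetP => [y _ //|] /(_ x) [].
  by exists 1; rewrite // (gmorph1 pM) mul1g.
have [δ δD δP] : exists2 δ : G -> E, forall x, D (δ x) & forall x, x = p (δ x) * s x.
  have /choice[δ δP] x : exists e, D e /\ x = p e * s x.
    by have [e] := sP x; exists e.
  by exists δ => x; case: (δP x).
have sD e x : D e -> s (p e * x) = s x.
  move=> De; rewrite /s; congr xget; apply/seteqP; split=> y [e' De' E'].
    exists (e^-1 * e'); first exact/DM/De'/DV.
    by rewrite pM -mulgA -E' (morphV pM) mulKg.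
  by exists (e * e'); [exact: DM|rewrite E' pM mulgA].
have δM e x : D e -> δ (p e * x) = e * δ x.
  move=> De; apply: pI => //; first exact: DM.
  apply: (@mulIg _ (s x)); rewrite -{1}(sD e) // -δP.
  by rewrite pM -mulgA -δP.
exists δ, s; split=> // x; split; first by rewrite {2}[x]δP sD.
by apply: (@mulgI _ (δ x)); rewrite -δM // -δP mulg1.
Qed.

(** * Amalgamation of two groups inside a symmetric group *)

(** Left multiplication on the factor [H] of [H * T'], transported to [T] along the bijection
    [f]. *)
Definition lmul_sym (T : Type) (H : groupType) (T' : Type)
    (f : T -> H * T') (f' : H * T' -> T) (fK : cancel f f') (f'K : cancel f' f)
    (h : H) : Sym T.
Proof.
apply: (@MkSym T (fun t => f' (h * (f t).1, (f t).2))
                 (fun t => f' (h^-1 * (f t).1, (f t).2))) => t.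
  by rewrite f'K /= mulKg -surjective_pairing fK.
by rewrite f'K /= mulVKg -surjective_pairing fK.
Defined.

Lemma lmul_symM T H T' f f' fK f'K : {morph @lmul_sym T H T' f f' fK f'K : x y / x * y}.
Proof. by move=> x y; apply: symP => t; rewrite symM /= f'K /= mulgA. Qed.

Lemma lmul_sym_inj T H T' f f' fK f'K : T -> injective (@lmul_sym T H T' f f' fK f'K).
Proof.
move=> t x y /(congr1 (fun s : Sym T => s t)) /= /(can_inj f'K) [].
exact: mulIg.
Qed.

(* [H] and [M] act on the two factors of [H * M]; swapping the [D]-components of
   the two coordinates conjugates the two resulting actions of [D]. *)
Lemma amalgam (H M : groupType) (D : set (H * M)) : partial_iso D ->
  exists (T : Type) (ρ : H -> Sym T) (σ : M -> Sym T),
  [/\ {morph ρ : x y / x * y} /\ {morph σ : x y / x * y}, injective ρ, injective σ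
    & forall p, D p -> ρ p.1 = σ p.2].
Proof.
move=> HD; have [Dsub Df Di] := HD.
have [|[h m] Dp /= e|δ [s [δD δP sD δM sK]]] := @coset_section _ _ D fst Dsub.
- by move=> [] ? ? [].
- by move: Dp; rewrite e => /Df ->.
have [|[h m] Dp /= e|ε [t [εD εP tD εM tK]]] := @coset_section _ _ D snd Dsub.
- by move=> [] ? ? [].
- by move: Dp; rewrite e => /Di ->.
pose θ (p : H * M) : H * M := ((ε p.2).1 * s p.1, (δ p.1).2 * t p.2).
have θK : involutive θ.
  move=> [a b]; rewrite /θ /= (sD (ε b)) // (tD (δ a)) //.
  rewrite (δM (ε b)) // (εM (δ a)) // (sK a).1 (sK a).2 (tK b).1 (tK b).2 !mulg1.
  by rewrite -δP -εP.
have idK : cancel (@id (H * M)) id by [].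
(* [lmul_sym] multiplies the first coordinate, so for [M] the coordinates are exchanged after
   applying [θ]. *)
have swK : cancel (fun p : H * M => ((θ p).2, (θ p).1)) (fun q => θ (q.2, q.1)).
  by move=> p; change (θ ((θ p).1, (θ p).2) = p); case: (θ p) (θK p).
have swK' : cancel (fun q => θ (q.2, q.1)) (fun p : H * M => ((θ p).2, (θ p).1)).
  by case=> b a; change (((θ (θ (a, b))).2, (θ (θ (a, b))).1) = (b, a)); rewrite θK.
exists (H * M)%type, (lmul_sym idK idK), (lmul_sym swK swK').
split.
- by split; apply: lmul_symM.
- by apply: lmul_sym_inj; exact: (1, 1).
- by apply: lmul_sym_inj; exact: (1, 1).
- move=> [h m] Dp; apply: symP => -[a b] /=.
  transitivity (θ ((θ (a, b)).1, m * (θ (a, b)).2)); last by [].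
  apply: (canRL θK); rewrite /θ /=.
  by rewrite (sD (h, m) a Dp) (δM (h, m) a Dp) /= mulgA.
Qed.

(** * The extension property and existentially closed groups *)

(** [D] is the graph of the prescribed embedding of a subgroup of [H], and [v] extends it to all of
    [H]. *)
Definition extension_property (d : Order.disp_t) (κ : orderType d) (M : groupType) :=
  forall (H : groupType) (D : set (H * M)),
    card_lt [set: H] [set: κ] -> partial_iso D ->
    exists v : H -> M, [/\ {morph v : x y / x * y}, injective v
      & forall p, D p -> v p.1 = p.2].

Section ExtensionProperty.
Context {d : Order.disp_t} {κ : orderType d} (hκ : inaccessible κ).

Local Notation small A := (card_lt A [set: κ]).

Lemma small_piso (H M : groupType) (D : set (H * M)) : partial_iso D ->
  small [set: H] -> small D.
Proof.
move=> HD; apply: (@small_inj _ _ _ _ fst) => // -[h m] [h' m'] Dp Dq /= e.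
by move: Dq; rewrite -e => /(piso_funP HD Dp) ->.
Qed.

(** The system has one variable for each element of [H]. It consists of the multiplication table of
    [H], the values prescribed by [D], and inequations forcing distinct values. The amalgam of [H]
    and [K] over [D] solves it in a supergroup of [K]. *)
Lemma ec_extension (K : groupType) :
  existentially_closed κ K -> extension_property κ K.
Proof.
move=> [_ ec] H D sH HD.
pose S : gsystem K H :=
  range (fun p : H * H => (true, (GMul (GVar K p.1) (GVar K p.2), GVar K (p.1 * p.2))))
  `|` (fun p => (true, (GVar K p.1, GCst H p.2))) @` D
  `|` (fun p => (false, (GVar K p.1, GVar K p.2))) @` [set p : H * H | p.1 <> p.2].
have sHH : small [set: H * H].
  by apply: small_sub (small_setX hκ sH sH) => p.
have sS : small S.
  apply: (small_setU hκ); last by apply: small_image; apply: small_sub sHH.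
  apply: (small_setU hκ); apply: small_image => //.
  exact: small_piso sH.
have [T [ρ [σ [[ρM σM] ρI σI ρσ]]]] := amalgam HD.
have [|v vP] := ec H S sS.
  pose i : {multiplicative K -> Sym T} := HB.pack_for {multiplicative K -> Sym T} σ
    (isMultiplicative.Build _ _ σ σM).
  exists (Sym T), i, ρ; split=> // b t u [[|]|] /= -[p] Dp [<- <- <-] /=.
  - by rewrite ρM.
  - exact: ρσ.
  - by move=> /ρI.
exists v; split.
- move=> x y; apply/esym.
  by apply: (vP true (GMul (GVar K x) (GVar K y)) (GVar K (x * y))); left; left; exists (x, y).
- move=> x y e; apply: contrapT => xy.
  by apply: (vP false (GVar K x) (GVar K y)) => //; right; exists (x, y).
- move=> p Dp.
  by apply: (vP true (GVar K p.1) (GCst H p.2)); left; right; exists p.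
Qed.

End ExtensionProperty.

(** * Transpositions, centre and size of symmetric groups *)

Definition transp_fun (T : Type) (a b x : T) : T :=
  if `[< x = a >] then b else if `[< x = b >] then a else x.

Lemma transp_funL (T : Type) (a b : T) : transp_fun a b a = b.
Proof. by rewrite /transp_fun asboolT. Qed.

Lemma transp_funR (T : Type) (a b : T) : transp_fun a b b = a.
Proof. by rewrite /transp_fun; case: asboolP => // _; rewrite asboolT. Qed.

Lemma transp_funD (T : Type) (a b x : T) : x <> a -> x <> b -> transp_fun a b x = x.
Proof. by move=> xa xb; rewrite /transp_fun !asboolF. Qed.

Lemma transp_funK (T : Type) (a b : T) : involutive (transp_fun a b).
Proof.
move=> x; have [->|xa] := pselect (x = a); first by rewrite transp_funL transp_funR.
have [->|xb] := pselect (x = b); first by rewrite transp_funR transp_funL.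
by rewrite !transp_funD.
Qed.

Definition transp (T : Type) (a b : T) : Sym T :=
  MkSym (transp_funK a b) (transp_funK a b).

Lemma ord_third n (T : Type) (f : 'I_n -> T) (x y : T) : (2 < n)%N -> injective f ->
  exists z, z <> x /\ z <> y.
Proof.
move=> n2 fI; apply: contrapT => N.
have H (i : 'I_n) : f i = x \/ f i = y.
  apply: contrapT => Ni; apply: N; exists (f i).
  by split=> e; apply: Ni; [left|right].
pose i0 := Ordinal (ltn_trans (isT : 0 < 2)%N n2).
pose i1 := Ordinal (ltn_trans (isT : 1 < 2)%N n2); pose i2 := Ordinal n2.
have ne i j : i <> j -> f i = f j -> False by move=> ij /fI.
case: (H i0) (H i1) (H i2) => [] e0 [] e1 [] e2.
- by apply: (ne i0 i1) => //; rewrite e0.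
- by apply: (ne i0 i1) => //; rewrite e0.
- by apply: (ne i0 i2) => //; rewrite e0.
- by apply: (ne i1 i2) => //; rewrite e1.
- by apply: (ne i1 i2) => //; rewrite e1.
- by apply: (ne i0 i2) => //; rewrite e0.
- by apply: (ne i0 i1) => //; rewrite e0.
- by apply: (ne i0 i1) => //; rewrite e0.
Qed.

(** If [s] moves [x], the transposition of [s x] with a third point [z] fixes [x] but moves [s x],
    so it does not commute with [s]. *)
Lemma center_Sym (T : Type) (s : Sym T) : (forall x y : T, exists z, z <> x /\ z <> y) ->
  (forall t, commute s t) -> s = 1.
Proof.
move=> third sC; apply: symP => x; apply: contrapT => sx.
have [z [zx zs]] := third x (s x).
have /(congr1 (fun t : Sym T => t x)) := sC (transp (s x) z).
rewrite !symM /= transp_funL transp_funD => [e||]; first exact: zs.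
  by move/esym.
by move/esym.
Qed.

(** A permutation is determined by its graph, a subset of [T * T]. *)
Lemma small_Sym (d : Order.disp_t) (κ : orderType d) (hκ : inaccessible κ) T :
  card_lt [set: T] [set: κ] -> card_lt [set: Sym T] [set: κ].
Proof.
move=> sT; have sTT : card_lt [set: T * T] [set: κ].
  by apply: small_sub (small_setX hκ sT sT) => p.
apply: small_le (small_power hκ sTT).
apply: (@inj_card_leP _ _ _ _ (fun s : Sym T => [set p | p.2 = s p.1])) => //.
move=> s t _ _ e; apply: symP => x.
by have : [set p | p.2 = s p.1] (x, s x) by []; rewrite e.
Qed.

(** * Stages of the limit group and its extension property *)

Section Limit.
Context {d : Order.disp_t} {κ : orderType d} {hκ : inaccessible κ} {n : nat}.
Context (L : regrep_limit hκ n) (n7 : (7 <= n)%N).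

Local Notation small A := (card_lt A [set: κ]).
Local Notation G_ := (rl_stage L).

Lemma ozero : exists α : κ, is_zero α.
Proof.
have [α0] := olt_inhab hκ.
have [m _ mP] := inacc_wo hκ (ex_intro setT α0 I).
by exists m => β; apply: mP.
Qed.

Lemma stage_third α (x y : subgrp (G_ α)) : exists z, z <> x /\ z <> y.
Proof.
have n2 : (2 < n)%N by apply: leq_trans n7.
have [α0 z0] := ozero; have [φ [ψ φK _]] := rl_zero L z0.
pose i0 := Ordinal (ltn_trans (isT : 0 < 2)%N n2).
(* The transpositions of 0 with [i] are distinct elements of the zeroth stage [Sym(n)], since they
   send 0 to [i]. This stage is contained in every other. *)
pose f (i : 'I_n) : subgrp (G_ α) := SubGrp (rl_le (r := L) (z0 α) (valP (φ (transp i0 i)))).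
apply: (@ord_third n _ f) => // i j e.
have /(can_inj φK)/(congr1 (fun t : Sym _ => t i0)) :
  φ (transp i0 i) = φ (transp i0 j) by apply: val_inj; case: e.
by rewrite /= !transp_funL.
Qed.

(** A non-limit stage is a symmetric group, on [n] points at zero and on [G_β] at the successor of
    [β]. Both sets have at least three points. *)
Lemma stage_center α (x : L) : nonlimit α -> x \in G_ α ->
  (forall y, y \in G_ α -> commute x y) -> x = 1.
Proof.
move=> nα xα xC.
have [T [[f fM fb] T3]] : exists T : Type,
    (exists2 f : Sym T -> subgrp (G_ α), {morph f : u v / u * v} & bijective f) /\
    forall a b : T, exists c, c <> a /\ c <> b.
  case: nα => [z0|[β e]].
    exists 'I_n; have [φ φb] := rl_zero L z0.
    split; first by exists φ => //; exact: gmulfM.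
    move=> a b; apply: (@ord_third n _ id) => //; exact: leq_trans n7.
  subst α; exists (subgrp (G_ β)); split; last exact: stage_third.
  have [g fK gK] := rl_sym_bij L β; exists g; last by exists (rl_sym L β).
  by apply: can2_gmulfM gK.
have [g fK gK] := fb.
have e : g (SubGrp xα) = 1.
  apply: center_Sym => // t; apply: (can_inj fK).
  rewrite !fM gK; apply: val_inj; exact: (xC (val (f t)) (valP (f t))).
have -> : x = val (f (g (SubGrp xα))) by rewrite gK.
by rewrite e (gmorph1 fM).
Qed.

(** Elements of [G_α] other than 1 act on [G_α] without fixed points, whereas the transposition of 1
    and [y] fixes [z] and moves 1. *)
Lemma stage_strict α : exists2 x, x \in G_ (osucc α) & x \notin G_ α.
Proof.
have [y [y1 _]] := stage_third (1 : subgrp (G_ α)) 1.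
have [z [z1 zy]] := stage_third 1 y.
have [g _ gK] := rl_sym_bij L α.
exists (val (g (transp 1 y))); first exact: valP.
apply/negP => xα; have E := rl_sym_reg (r := L) (x := SubGrp xα) z erefl.
have := E; rewrite gK /= transp_funD // => /esym e.
have x1 : SubGrp xα = 1 by apply: invg_inj; apply: (@mulgI _ z); rewrite invg1 mulg1.
have := rl_sym_reg (r := L) (x := SubGrp xα) 1 (erefl : val (g (transp 1 y)) = _).
by rewrite gK /= transp_funL x1 invg1 mulg1.
Qed.

Lemma small_stage α : small [set x | x \in G_ α].
Proof.
elim/(well_founded_ind (olt_wf hκ)): α => α IH.
have sub β : small [set x | x \in G_ β] -> small [set: subgrp (G_ β)].
  move=> sβ; apply: small_le sβ; apply: (@inj_card_leP _ _ _ _ val) => [x _|x y _ _].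
    exact: (valP x).
  exact: val_inj.
have [[z0|[β e]]|Nα] := pselect (nonlimit α).
- have [φ [ψ φK ψK]] := rl_zero L z0.
  apply: (@small_sub _ _ _ _ (range (fun s => val (φ s)))).
    by move=> x xα; exists (ψ (SubGrp xα)) => //; rewrite ψK.
  apply: small_image; apply: small_Sym => //.
  exact/(small_countable hκ)/countableP.
- subst α; have [g gK Kg] := rl_sym_bij L β.
  apply: (@small_sub _ _ _ _ (range (fun s => val (g s)))).
    by move=> x xα; exists (rl_sym L β (SubGrp xα)) => //; rewrite gK.
  by apply: small_image; apply: small_Sym => //; apply/sub/IH/osucc_gt.
- apply: (@small_sub _ _ _ _ (\bigcup_(β in [set β | (β < α)%O]) [set x | x \in G_ β])).
    by move=> x /(rl_limit Nα)[β βα xβ]; exists β.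
  by apply: small_bigcup => //; apply: inacc_card.
Qed.

(** Elements are ranked by the first stage containing them. Those of rank at most [a] lie in the
    small stage [G_a]. *)
Lemma limit_lekappa : [set: L] #<= [set: κ].
Proof.
have /choice[r rP] x : exists α, x \in G_ α /\ forall β, x \in G_ β -> (α <= β)%O.
  have [β xβ] := rl_cover (r := L) x.
  by have [α] := inacc_wo hκ (ex_intro (fun α => x \in G_ α) β xβ); exists α.
apply: (card_le_rank hκ (r := r)) => a.
  apply: small_sub (small_stage (α := a)) => x /= ra.
by apply: rl_le ra _ _; case: (rP x).
Qed.

(** Choosing for each [α] an element that lies in [G_(α+1)] but not in [G_α] injects κ into [L]. *)
Lemma limit_notsmall : ~ small [set: L].
Proof.
have /choice[x xP] α : exists x, x \in G_ (osucc α) /\ x \notin G_ α.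
  by have [x] := stage_strict α; exists x.
have xD α β : (α < β)%O -> x α <> x β.
  move=> /(osucc_le hκ)/rl_le ab e; have [_ /negP] := xP β; apply.
  by rewrite -e; apply: ab; case: (xP α).
apply; apply: (@inj_card_leP _ _ _ _ x) => // α β _ _ e.
by case: (ltgtP α β) => // /xD; rewrite e.
Qed.

Lemma stage_bounded (A : set L) : small A ->
  exists α, forall x, A x -> x \in G_ α.
Proof.
move=> sA; have /choice[r rP] x := rl_cover (r := L) x.
have [a aP] := small_bounded hκ (small_image (f := r) sA).
exists a => x Ax; apply: rl_le (rP x); apply/ltW/aP.
by exists x.
Qed.

(* [H * L] and [L] are free [D]-sets with [κ] orbits, hence equivariantly in
   bijection. *)
Lemma equivariant_bijection (H : groupType) (D : set (H * L)) :
  small [set: H] -> partial_iso D ->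
  exists (θ : H * L -> L) (θ' : L -> H * L), [/\ cancel θ θ', cancel θ' θ
    & forall p h y, D p -> θ (p.1 * h, y) = p.2 * θ (h, y)].
Proof.
move=> sH HD; have [Dsub Df Di] := HD.
have [|[h m] Dp /= e|δ [s [δD δP sD δM sK]]] := @coset_section _ _ D fst Dsub.
- by move=> [] ? ? [].
- by move: Dp; rewrite e => /Df ->.
have [|[h m] Dp /= e|ε [t [εD εP tD εM tK]]] := @coset_section _ _ D snd Dsub.
- by move=> [] ? ? [].
- by move: Dp; rewrite e => /Di ->.
(* [X] and [Y] are sets of representatives for the [D]-orbits on [H * L] and on [L]. A bijection [j]
   between them extends equivariantly to [θ]. *)
pose X : set (H * L) := range s `*` [set: L]; pose Y : set L := range t.
have Lκ := limit_lekappa; have NL := limit_notsmall.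
have XY : X #= Y.
  apply: (@card_eq_kappa _ κ).
  - apply: card_le_trans (card_leT _) _.
    by apply: (card_prod_kappa hκ) => //; apply: small_lekappa.
  - move=> sX; apply: NL; apply: small_le sX.
    apply: (@inj_card_leP _ _ _ _ (pair (s 1))) => [y _|y z _ _ []//].
    by split=> //; exists 1.
  - exact: card_le_trans (card_leT _) Lκ.
  - move=> sY; apply: NL.
    (* Every [y] is [(ε y).2 * t y] and [D] is small, so a small [Y] would make [L] small. *)
    apply: small_sub (small_image (f := fun q => q.1.2 * q.2)
      (small_setX hκ (small_piso HD sH) sY)) => y _.
    by exists (ε y, t y); [split; [exact: εD|exists y]|rewrite /= -εP].
have [j [j' [jY j'X jK j'K]]] := card_eq_inverse (1, 1) 1 XY.
pose θ (p : H * L) := (δ p.1).2 * j (s p.1, p.2).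
pose θ' (y : L) := ((ε y).1 * (j' (t y)).1, (j' (t y)).2).
have tY y : Y y -> t y = y /\ ε y = 1.
  by move=> [z _ <-]; split; [exact: (tK z).1|exact: (tK z).2].
have sX h : range s h -> s h = h /\ δ h = 1.
  by move=> [z _ <-]; split; [exact: (sK z).1|exact: (sK z).2].
exists θ, θ'; split.
- move=> [h y]; have Xp : X (s h, y) by split=> //; exists h.
  have [tj εj] := tY _ (jY _ Xp).
  rewrite /θ /θ' /= (tD (δ h)) // (εM (δ h)) // tj εj mulg1 jK //=.
  by rewrite -δP.
- move=> y; have Yy : Y (t y) by exists y.
  have [Xs _] := j'X _ Yy; have [sj δj] := sX _ Xs.
  rewrite /θ /θ' /= (sD (ε y)) // (δM (ε y)) // sj δj mulg1 -surjective_pairing.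
  by rewrite j'K // -εP.
- by move=> p h y Dp; rewrite /θ /= sD // δM //= mulgA.
Qed.

Lemma limit_extension : extension_property κ L.
Proof.
move=> H D sH HD; have [θ [θ' [θK θ'K θM]]] := equivariant_bijection sH HD.
have [α0 Dα0] := stage_bounded (small_image (f := snd) (small_piso HD sH)).
(* [F α] is a stage that contains all values reached from [G_α] by [θ] and by the second component
   of [θ']. *)
have /choice[F FP] α : exists β, forall h y, y \in G_ α ->
    θ (h, y) \in G_ β /\ (θ' y).2 \in G_ β.
  have [|β βP] := @stage_bounded ([set θ p | p in [set: H] `*` [set y | y \in G_ α]]
      `|` [set (θ' y).2 | y in [set y | y \in G_ α]]).
    apply: (small_setU hκ); apply: small_image; last exact: small_stage.
    by apply: (small_setX hκ) => //; apply: small_stage.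
  exists β => h y yα; split; apply: βP; first by left; exists (h, y).
  by right; exists y.
(* The stage [G_γ] is closed under these maps and contains the range of [D]. *)
have [γ [Nγ α0γ Fγ]] := limit_closed hκ F α0.
have θγ h y : y \in G_ γ -> θ (h, y) \in G_ γ /\ (θ' y).2 \in G_ γ.
  move=> /(rl_limit Nγ)[α /Fγ[β [αβ /ltW Fβ βγ]] yα].
  by have [/(rl_le Fβ) ? /(rl_le Fβ) ?] := FP β h y (rl_le αβ yα).
pose T := subgrp (G_ γ).
(* The inverses convert the left action [y |-> m * y] into [y |-> y * m^-1], which is how [m] acts
   on [G_γ] as an element of [G_(γ+1)]. *)
pose f (x : T) : H * T := ((θ' (val x)^-1).1, SubGrp (θγ 1 _ (valP x^-1)).2).
pose f' (p : H * T) : T := (SubGrp (θγ p.1 _ (valP p.2)).1)^-1.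
have fK : cancel f f'.
  move=> x; apply: invg_inj; rewrite invgK; apply: val_inj => /=.
  by rewrite -surjective_pairing θ'K.
have f'K : cancel f' f.
  move=> [h y]; congr (_, _); last apply: val_inj => /=.
    by rewrite /= invgK θK.
  by rewrite invgK θK.
have [g symK gK] := rl_sym_bij L γ.
pose ρ := lmul_sym fK f'K.
exists (fun h => val (g (ρ h))); split.
- by move=> h k; rewrite /ρ lmul_symM (can2_gmulfM symK gK).
- move=> h k /val_inj/(can_inj gK); apply: lmul_sym_inj; exact: 1.
- move=> [h m] Dp.
  have mγ : m \in G_ γ by apply: rl_le (ltW α0γ) _ (Dα0 _ _); exists (h, m).
  have mγ' : m \in G_ (osucc γ) by apply: rl_le (ltW (osucc_gt hκ γ)) _ mγ.
  rewrite /=; have -> : ρ h = rl_sym L γ (SubGrp mγ'); last by rewrite symK.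
  apply: symP => y.
  rewrite (rl_sym_reg (x := SubGrp mγ) y) //.
  have E := θM (h, m) (θ' (val y)^-1).1 (θ' (val y)^-1).2 Dp.
  apply: invg_inj; rewrite /= invgK; apply: val_inj; rewrite invgM invgK /=.
  by move: E => /= ->; rewrite -surjective_pairing θ'K.
Qed.

End Limit.

(** * Branching back-and-forth construction of isomorphisms *)

Section BackAndForth.
Context {d : Order.disp_t} {κ : orderType d} (hκ : inaccessible κ).

Local Notation small A := (card_lt A [set: κ]).

Lemma small_generated (G : groupType) (A : set G) : small A -> small (generated A).
Proof.
move=> sA; apply: small_image; apply: (small_seq hκ).
by apply: (small_setU hκ) => //; apply: small_image.
Qed.

(** The domain of [R] together with [x] generates a small subgroup of [M]. The extension property of
    [N] extends [R] to it. *)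
Lemma forth (M N : groupType) (R : set (M * N)) (x : M) :
  extension_property κ N -> partial_iso R -> small R ->
  exists R' : set (M * N), [/\ partial_iso R', small R', R `<=` R'
    & exists y, R' (x, y)].
Proof.
move=> EN HR sR; pose A : set M := fst @` R `|` [set x].
have sA : small (generated A).
  apply: small_generated; apply: (small_setU hκ); first exact: small_image.
  exact/(small_countable hκ)/countable1.
have [H [i [iM iI iA]]] := subgroup_type (generatedP A).
have AH a : A a -> exists h, i h = a.
  by move=> /(@sub_generated _ A); rewrite -iA => -[h _ <-]; exists h.
have sH : small [set: H].
  apply: small_le sA; apply: (@inj_card_leP _ _ _ _ i) => [h _|h k _ _ /iI //].
  by rewrite -iA; exists h.
pose D : set (H * N) := [set p | R (i p.1, p.2)].
have [v [vM vI vD]] : exists v : H -> N, [/\ {morph v : x y / x * y}, injective v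
      & forall p, D p -> v p.1 = p.2].
  apply: EN => //; have [[R1 RM RV] Rf Ri] := HR; have i1 := gmorph1 iM.
  split; first split.
  - by rewrite /D /= i1.
  - by move=> p q Dp Dq; rewrite /D /= iM; exact: RM Dp Dq.
  - by move=> p Dp; rewrite /D /= (morphV iM); exact: RV Dp.
  - by move=> y; rewrite /D /= i1; apply: Rf.
  - by move=> h /Ri; rewrite -i1 => /iI.
exists (range (fun h => (i h, v h))); split.
- exact: range_piso.
- exact: small_image.
- move=> [a b] Rab; have [|h ih] := AH a; first by left; exists (a, b).
  by exists h => //; rewrite (vD (h, b)) /D /= ih.
- by have [|h ih] := AH x; [right|exists (v h), h; rewrite // ih].
Qed.

(* The automorphism of [R * Z * Z] exchanging the two copies of [Z] fixes [R],
   which gives two embeddings of this group over [R]. *)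
Lemma split_piso (M N : groupType) (R : set (M * N)) :
  extension_property κ M -> extension_property κ N -> partial_iso R -> small R ->
  exists R' : bool -> set (M * N),
    (forall b, [/\ partial_iso (R' b), small (R' b) & R `<=` R' b]) /\
    exists x y1 y2, [/\ y1 <> y2, R' true (x, y1) & R' false (x, y2)].
Proof.
move=> EM EN HR sR; have [Rsub Rf Ri] := HR.
have [Q [i [iM iI iR]]] := subgroup_type Rsub.
have Ri' q : R (i q) by rewrite -iR; exists q.
have i1 := gmorph1 iM.
(* [Sym bool] serves as the group of order two, with nontrivial element [z]. *)
pose Z : groupType := Sym bool; pose H : groupType := (Q * (Z * Z))%type.
pose z : Z := transp true false.
have z1 : z <> 1.
  by move/(congr1 (fun t : Sym bool => t true)); rewrite /= transp_funL.
have sH : small [set: H].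
  have sZ : small [set: Z].
    exact/(small_Sym hκ)/(small_countable hκ)/countableP.
  have sQ : small [set: Q].
    apply: small_le sR; apply: (@inj_card_leP _ _ _ _ i) => // x y _ _; apply: iI.
  apply: small_sub (small_setX hκ sQ (small_setX hκ sZ sZ)) => //.
have emb (P : groupType) (p : M * N -> P) : extension_property κ P ->
    {morph p : x y / x * y} -> (forall q, R q -> p q = 1 -> q = 1) ->
    exists v : H -> P, [/\ {morph v : x y / x * y}, injective v
      & forall q, v (q, (1, 1)) = p (i q)].
  move=> EP pM p1.
  pose D : set (H * P) := range (fun q : Q => ((q, (1, 1)), p (i q))).
  have pI : injective (p \o i).
    apply: gmorph_inj => [x y|q /= /p1]; first by rewrite /= iM pM.
    by rewrite -i1 => /(_ (Ri' q)) /iI.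
  have [v [vM vI vD]] : exists v : H -> P, [/\ {morph v : x y / x * y}, injective v
      & forall q, D q -> v q.1 = q.2].
    apply: EP => //; apply: range_piso => //.
    - by move=> x y; congr (_, (_, _)); rewrite mulg1.
    - by move=> x y; rewrite iM pM.
    - by move=> x y [].
  by exists v; split=> // q; apply: (vD (_, _)); exists q.
have [|||u [uM uI uR]] := emb M fst => //.
  by move=> [a b] Rp /= e; move: Rp; rewrite e => /Rf ->.
have [|||v [vM vI vR]] := emb N snd => //.
  by move=> [a b] Rp /= e; move: Rp; rewrite e => /Ri ->.
(* Both [v] and [v \o sw] extend the second projection on [R], but they send [(1, (z, 1))] to
   different elements. *)
pose sw (h : H) : H := (h.1, (h.2.2, h.2.1)).
have swM : {morph sw : x y / x * y} by [].
have swI : injective sw by move=> [q [a b]] [q' [a' b']] [-> -> ->].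
exists (fun b => range (fun h => (u h, if b then v h else v (sw h)))); split.
  case; (split; [apply: range_piso => //|exact: small_image|]).
  - move=> p; rewrite -iR => -[q _ <-]; exists (q, (1, 1)) => //.
    by rewrite uR vR -surjective_pairing.
  - by move=> x y; rewrite swM vM.
  - by move=> x y /vI/swI.
  - move=> p; rewrite -iR => -[q _ <-]; exists (q, (1, 1)) => //.
    by rewrite /sw /= uR vR -surjective_pairing.
exists (u (1, (z, 1))), (v (1, (z, 1))), (v (1, (1, z))); split.
- by move=> /vI e; apply: z1; apply: (congr1 (fun h : H => h.2.1) e).
- by exists (1, (z, 1)).
- by exists (1, (z, 1)).
Qed.

(** [R] is first split into two incompatible extensions. Each is then extended to contain [x] in its
    domain and, after exchanging coordinates, [y] in its range. Incompatibility persists under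
    extension. *)
Lemma back_and_forth_step (M N : groupType) (R : set (M * N)) (x : M) (y : N) :
  extension_property κ M -> extension_property κ N -> partial_iso R -> small R ->
  exists R' : bool -> set (M * N),
    (forall b, [/\ partial_iso (R' b), small (R' b), R `<=` R' b
       & (exists y', R' b (x, y')) /\ exists x', R' b (x', y)]) /\
    exists x0 y1 y2, [/\ y1 <> y2, R' true (x0, y1) & R' false (x0, y2)].
Proof.
move=> EM EN HR sR; have [R1 [R1P [x0 [y1 [y2 [y12 Rt Rf]]]]]] := split_piso EM EN HR sR.
have /choice[R' R'P] b : exists R', [/\ partial_iso R', small R', R1 b `<=` R'
       & (exists y', R' (x, y')) /\ exists x', R' (x', y)].
  have [H1 s1 _] := R1P b.
  have [R2 [H2 s2 R12 [y' Ry']]] := forth x EN H1 s1.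
  have [|R3 [H3 s3 R23 [x' Rx']]] := forth y EM (piso_swap H2).
    apply: (small_inj (f := fun p => (p.2, p.1))) s2 => // -[a b'] [a' b''] _ _ /=.
    by move=> [-> ->].
  exists [set p | R3 (p.2, p.1)]; split.
  - exact: piso_swap.
  - apply: (small_inj (f := fun p => (p.2, p.1))) s3 => // -[a b'] [a' b''] _ _ /=.
    by move=> [-> ->].
  - by move=> [a b'] /R12 ?; apply: R23.
  - by split; [exists y'; apply: R23|exists x'].
exists R'; split.
  move=> b; have [H s Rb xy] := R'P b; split=> //.
  by have [_ _ RR] := R1P b; apply: subset_trans RR Rb.
exists x0, y1, y2; split=> //.
  by have [_ _ Rb _] := R'P true; apply: Rb.
by have [_ _ Rb _] := R'P false; apply: Rb.
Qed.

(** The identity pair is adjoined because the union is empty when [α] is zero. *)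
Lemma piso_chain (M N : groupType) (R : κ -> set (M * N)) (α : κ) :
  (forall β, (β < α)%O -> partial_iso (R β)) ->
  (forall β γ, (β <= γ)%O -> (γ < α)%O -> R β `<=` R γ) ->
  partial_iso ([set 1] `|` \bigcup_(β in [set β | (β < α)%O]) R β).
Proof.
move=> HR inc; split; first split.
- by left.
- move=> p q [->|[β βα Rp]]; first by rewrite mul1g.
  case=> [->|[γ γα Rq]]; first by rewrite mulg1; right; exists β.
  right; have [βγ|/ltW γβ] := leP β γ.
    by exists γ => //; apply: (subM (piso_sub (HR γ γα))) => //; apply: inc βγ _ _ Rp.
  by exists β => //; apply: (subM (piso_sub (HR β βα))) => //; apply: inc γβ _ _ Rq.
- move=> p [->|[β βα Rp]]; first by left; rewrite invg1.
  by right; exists β => //; apply: subV (piso_sub (HR β βα)) _ Rp.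
- by move=> y [[]|[β βα]]; [|apply: piso_fun (HR β βα) _].
- by move=> x [[]|[β βα]]; [|apply: piso_inj (HR β βα) _].
Qed.

Lemma card_le_enum (M : groupType) : [set: M] #<= [set: κ] ->
  exists k : κ -> M, forall x, exists α, k α = x.
Proof.
have [α0] := olt_inhab hκ => /(card_le_inj α0)[f _ fI].
exists (fun α => xget 1 [set x | f x = α]) => x; exists (f x).
by case: xgetP => [y _ /= e|/(_ x) []//]; exact: (fI _ _ I I e).
Qed.

(** Stage [α] handles the [α]-th elements of enumerations of [M] and [N], and takes the branch given
    by whether [α] belongs to [e]. The union over all stages is the graph of [F e]. *)
Lemma back_and_forth (M N : groupType) :
  extension_property κ M -> extension_property κ N ->
  [set: M] #<= [set: κ] -> [set: N] #<= [set: κ] ->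
  exists F : set κ -> M -> N,
    (forall e, {morph F e : x y / x * y} /\ bijective (F e)) /\ injective F.
Proof.
move=> EM EN /card_le_enum[k kP] /card_le_enum[l lP].
have /choice[E EP] (t : set (M * N) * (M * N)) : exists R' : bool -> set (M * N),
    partial_iso t.1 -> small t.1 ->
    (forall b, [/\ partial_iso (R' b), small (R' b), t.1 `<=` R' b
       & (exists y', R' b (t.2.1, y')) /\ exists x', R' b (x', t.2.2)]) /\
    exists x0 y1 y2, [/\ y1 <> y2, R' true (x0, y1) & R' false (x0, y2)].
  have [[HR sR]|N'] := pselect (partial_iso t.1 /\ small t.1).
    by have [R' R'P] := back_and_forth_step t.2.1 t.2.2 EM EN HR sR; exists R'.
  by exists (fun=> set0) => HR sR; case: N'.
(* The recursion supplies the empty set at ordinals not below the current stage, so the union over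
   all of κ collects exactly the earlier stages. *)
pose pre (f : κ -> set (M * N)) := [set 1] `|` \bigcup_(β in setT) f β.
pose R (e : set κ) := wfrec hκ set0 (fun α f => E (pre f, (k α, l α)) `[< e α >]).
pose P (e : set κ) (α : κ) := [set 1] `|` \bigcup_(β in [set β | (β < α)%O]) R e β.
have RE e α : R e α = E (P e α, (k α, l α)) `[< e α >].
  rewrite {1}/R wfrecE -/(R e); suff -> : pre (below set0 α (R e)) = P e α by [].
  congr (_ `|` _); apply/seteqP; split=> p [β].
    by rewrite /below => _; case: ifP => // βα Rp; exists β.
  by move=> βα Rp; exists β => //; rewrite /below βα.
have good e α : [/\ partial_iso (R e α), small (R e α) & P e α `<=` R e α].
  elim/(well_founded_ind (olt_wf hκ)): α => α IH.
  have HP : partial_iso (P e α).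
    apply: piso_chain => [β /IH[]//|β γ]; rewrite le_eqVlt => /orP[/eqP-> _ p //|βγ γα].
    have [_ _] := IH γ γα; apply: subset_trans => p Rp; right.
    by exists β.
  have sP : small (P e α).
    apply: (small_setU hκ); first exact/(small_countable hκ)/countable1.
    by apply: (small_bigcup hκ) => [|β /IH[]//]; apply: inacc_card.
  by have [/(_ `[< e α >])[H s PR _] _] := EP (P e α, (k α, l α)) HP sP; rewrite RE.
have goodP e α : partial_iso (P e α) /\ small (P e α).
  split.
    apply: piso_chain => [β _|β γ]; first by have [] := good e β.
    rewrite le_eqVlt => /orP[/eqP-> _ p //|βγ γα].
    have [_ _] := good e γ; apply: subset_trans => p Rp; right.
    by exists β.
  by have [_ s PR] := good e α; apply: small_sub s.
have inc e β γ p : (β <= γ)%O -> R e β p -> R e γ p.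
  rewrite le_eqVlt => /orP[/eqP-> //|βγ] Rp; have [_ _] := good e γ; apply.
  by right; exists β.
have ext e α := EP (P e α, (k α, l α)) (goodP e α).1 (goodP e α).2.
have /choice[F FP] e : exists F : M -> N, forall x, exists α, R e α (x, F x).
  suff /choice[F FP] : forall x, exists y, exists α, R e α (x, y) by exists F.
  move=> x; have [α <-] := kP x.
  have [/(_ `[< e α >])[_ _ _ [[y Ry] _]] _] := ext e α.
  by exists y, α; rewrite RE.
have Ffun e α x y : R e α (x, y) -> y = F e x.
  have [β Rβ] := FP e x => Rα.
  have [mβ mα] : (β <= Order.max α β)%O /\ (α <= Order.max α β)%O.
    by rewrite !le_max !lexx orbT.
  have [H _ _] := good e (Order.max α β).
  by apply: (piso_funP H); [apply: inc mα Rα|apply: inc mβ Rβ].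
have two e x x' : exists α, R e α (x, F e x) /\ R e α (x', F e x').
  have [[α Rα] [β Rβ]] := (FP e x, FP e x'); exists (Order.max α β).
  by split; [apply: inc Rα|apply: inc Rβ]; rewrite le_max lexx ?orbT.
exists F; split.
  move=> e; split=> [x x'|].
    have [α [Rx Rx']] := two e x x'; have [H _ _] := good e α.
    by apply/esym/(Ffun e α)/(subM (piso_sub H) Rx Rx').
  have FI : injective (F e).
    move=> x x' exx; have [α [Rx Rx']] := two e x x'; have [H _ _] := good e α.
    by apply: (piso_injP H Rx); rewrite exx.
  have /choice[G GK] y : exists x, F e x = y.
    have [α <-] := lP y.
    have [/(_ `[< e α >])[_ _ _ [_ [x Rx]]] _] := ext e α.
    by exists x; apply/esym/(Ffun e α); rewrite RE.
  by exists G => // x; apply: FI; rewrite GK.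
(* If [e] and [e'] agree below [α], both constructions reach stage [α] with the same partial
   isomorphism. Different branches there would give [x0] two images. *)
move=> e e' ee; apply/funext; elim/(well_founded_ind (olt_wf hκ)) => α IH.
have PP β : (β <= α)%O -> P e β = P e' β.
  elim/(well_founded_ind (olt_wf hκ)): β => β IHβ βα.
  congr (_ `|` _); apply: eq_bigcupr => γ /= γβ.
  by rewrite !RE (IHβ γ) ?(IH γ) //; [apply: lt_le_trans βα|apply/ltW/(lt_le_trans γβ)].
have [_ [x0 [y1 [y2 [y12 R1 R2]]]]] := ext e α.
have := RE e α; have := RE e' α; rewrite -PP //.
case: asboolP => e'α; case: asboolP => eα Re' Re.
- exact/propext.
- case: y12; transitivity (F e' x0); first by apply: (Ffun e' α); rewrite Re'.
  by rewrite -ee; apply/esym/(Ffun e α); rewrite Re.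
- case: y12; transitivity (F e x0); first by apply: (Ffun e α); rewrite Re.
  by rewrite ee; apply/esym/(Ffun e' α); rewrite Re'.
- exact/propext.
Qed.

End BackAndForth.

(** * The faithful action of the twisted product on the limit group *)

Section TwistedAction.
Context {d : Order.disp_t} {κ : orderType d} {hκ : inaccessible κ} {n : nat}.
Context (L : regrep_limit hκ n) (n7 : (7 <= n)%N).
Implicit Types g h : twisted L.

Local Notation G_ := (rl_stage L).

(** The union of the restrictions of [Phi g α] to [G_α], evaluated at a chosen stage containing [x].
    Coherence of these maps makes the value independent of the stage. *)
Definition tw_act g (x : L) : L := Phi g (projT1 (cid (rl_cover x))) x.

Lemma tw_actE g α x : x \in G_ α -> tw_act g x = Phi g α x.
Proof.
rewrite /tw_act; case: cid => β /= xβ xα; case/orP: (le_total α β) => ab.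
  by rewrite (Phi_coh (Phi_goodP g β) ab xα).
by rewrite (Phi_coh (Phi_goodP g α) ab xβ).
Qed.

Lemma tw_actM g : {morph tw_act g : x y / x * y}.
Proof.
move=> x y; have [[α xα] [β yβ]] := (rl_cover x, rl_cover y).
have xm : x \in G_ (Order.max α β) by apply: rl_le xα; rewrite le_max lexx.
have ym : y \in G_ (Order.max α β) by apply: rl_le yβ; rewrite le_max lexx orbT.
have xym : x * y \in G_ (Order.max α β) by apply: gpredM.
by rewrite (tw_actE g xm) (tw_actE g ym) (tw_actE g xym) PhiM.
Qed.

Lemma tw_act_mul g h x : tw_act (g * h) x = tw_act g (tw_act h x).
Proof.
have [α xα] := rl_cover x; rewrite !(tw_actE _ xα) Phi_mul /=.
by apply/esym/tw_actE; rewrite (Phi_stage (Phi_goodP h α)).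
Qed.

Lemma tw_act_one x : tw_act 1 x = x.
Proof. by rewrite /tw_act Phi_one. Qed.

(** At a successor, the preceding [Phi] is conjugation by an element of [G_α], hence maps [G_α] onto
    itself. *)
Lemma Phi_prev_onto g α y : y \in G_ α ->
  exists2 x, x \in G_ α & Phi_prev g α x = y.
Proof.
move=> yα; rewrite /Phi_prev; case e: opred => [β|]; last by exists y.
have eα := opred_Some e; subst α; have [c cβ ->] := Phi_inner (Phi_goodP g β).
by exists (inner c^-1 y); [rewrite inner_in ?gpredV|apply: innerKV].
Qed.

(** By induction, the maps [Phi] agree before [α]. At a limit they determine the next one. At a
    non-limit [α], conjugations by [g_α] and [h_α] then agree on [G_α], so the two elements differ
    by a central element of [G_α], which is trivial. *)
Lemma tw_act_inj g h : tw_act g =1 tw_act h -> g = h.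
Proof.
move=> gh; suff H α : Phi g α = Phi h α /\ forall k : nonlimit α,
    g (exist _ α k) = h (exist _ α k).
  by apply: twistedP => -[α k]; have [_ ->] := H α.
elim/(well_founded_ind (olt_wf hκ)): α => α IH.
have [k|Nα] := pselect (nonlimit α); last first.
  split=> // ; rewrite !Phi_limit //; congr inner; rewrite /psi; congr xget.
  apply/seteqP; split=> p /= -[s sp H]; exists s => // β x βα xβ.
    by rewrite (H β) // (IH β βα).1.
  by rewrite (H β) // (IH β βα).1.
have prev : Phi_prev g α = Phi_prev h α.
  rewrite /Phi_prev; case e: opred => [β|//].
  by rewrite (IH β _).1 // (opred_Some e) osucc_gt.
have [gα _] := twP g k; have [hα _] := twP h k.
have ghk : g (exist _ α k) = h (exist _ α k).
  set a := g _ in gα *; set b := h _ in hα *.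
  (* Each [y] in [G_α] is the image of some [x] in [G_α] under the common preceding map, and the two
     actions agree on [x]. *)
  have inn y : y \in G_ α -> inner a y = inner b y.
    move=> yα; have [x xα <-] := Phi_prev_onto g yα; rewrite {2}prev.
    by have := gh x; rewrite !(tw_actE _ xα) !(Phi_nonlimit _ k).
  suff ab : b^-1 * a = 1 by rewrite -[LHS](mulVKg b) ab mulg1.
  apply: (stage_center n7 k) => [|y yα]; first by rewrite gpredM ?gpredV.
  apply: (@mulgI _ b); apply: (@mulIg _ a^-1).
  by have := inn y yα; rewrite /inner !mulgA mulgV mul1g mulgK.
split=> [|k']; last by rewrite (Prop_irrelevance k' k).
by apply/funext => x; rewrite !(Phi_nonlimit _ k) prev ghk.
Qed.

(** The action on [L] is conjugated by [F] into an action on [K], which remains faithful. *)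
Lemma twisted_embedding (K : groupType) (F : K -> L) :
  {morph F : x y / x * y} -> bijective F ->
  exists f : {multiplicative twisted L -> Aut K}, injective f.
Proof.
move=> FM [F' FK F'K].
have F'M : {morph F' : x y / x * y}.
  by move=> x y; apply: (can_inj FK); rewrite FM !F'K.
pose a g x := F' (tw_act g (F x)).
have aM g h x : a (g * h) x = a g (a h x) by rewrite /a F'K tw_act_mul.
have a1 x : a 1 x = x by rewrite /a tw_act_one FK.
have aK g : cancel (a g) (a g^-1) by move=> x; rewrite -aM mulVg a1.
have aKV g : cancel (a g^-1) (a g) by move=> x; rewrite -aM mulgV a1.
have aA g : sgpred (autom K) (MkSym (aK g) (aKV g)).
  by apply/asboolP => x y; rewrite /= /a FM tw_actM F'M.
pose f g : Aut K := SubGrp (aA g).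
have fM : {morph f : g h / g * h}.
  by move=> g h; apply: val_inj; apply: symP => x; apply: aM.
pose fm : {multiplicative twisted L -> Aut K} :=
  HB.pack_for {multiplicative twisted L -> Aut K} f (isMultiplicative.Build _ _ f fM).
exists fm => g h /(congr1 val) /= e; apply: tw_act_inj => x.
apply: (can_inj F'K).
by have := congr1 (fun s : Sym K => s (F' x)) e; rewrite /= /a F'K.
Qed.

End TwistedAction.

(** * The size of the automorphism group and the conclusion *)

(** Graphs of automorphisms are subsets of [K * K], which gives the upper bound. Back-and-forth
    between [K] and itself gives the lower one. *)
Lemma card_Aut (d : Order.disp_t) (κ : orderType d) (hκ : inaccessible κ) (K : groupType) :
  extension_property κ K -> [set: K] #<= [set: κ] -> [set: Aut K] #= [set: set κ].
Proof.
move=> EK Kκ; apply/card_eqPle; split.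
  apply: card_le_trans (card_le_set (card_prod_kappa hκ Kκ Kκ)).
  apply: (@inj_card_leP _ _ _ _ (fun s : Aut K => [set p | p.2 = val s p.1])) => //.
  move=> s t _ _ e; apply: val_inj; apply: symP => x.
  by have : [set p | p.2 = val s p.1] (x, val s x) by []; rewrite e.
have [F [FP FI]] := back_and_forth hκ EK EK Kκ Kκ.
have /choice[f fP] e : exists s : Aut K, F e = val s.
  have [FM [F' FK F'K]] := FP e.
  have FA : sgpred (autom K) (MkSym FK F'K) by apply/asboolP.
  by exists (SubGrp FA).
apply: (@inj_card_leP _ _ _ _ f) => // e e' _ _ ee; apply: FI.
by rewrite !fP ee.
Qed.

Theorem corollary16 (d : Order.disp_t) (κ : orderType d)
    (hκ : inaccessible κ) (K : groupType)
    (K_ec : existentially_closed κ K) (K_card : [set: K] #= [set: κ]) :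
  (forall (n : nat) (L : regrep_limit hκ n), (7 <= n)%N ->
     exists f : {multiplicative twisted L -> Aut K}, injective f) /\
  [set: Aut K] #= [set: set κ].
Proof.
have EK := ec_extension hκ K_ec.
have Kκ : [set: K] #<= [set: κ] by case/card_eqPle: K_card.
split; last exact: (card_Aut hκ).
move=> n L n7; have [F [FP _]] := back_and_forth hκ EK (limit_extension n7) Kκ
  (limit_lekappa L).
(* The index [set0] selects one isomorphism of the family. *)
by have [FM Fbij] := FP set0; apply: twisted_embedding FM Fbij.
Qed.
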